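(* The Fractional Generalized Perturbed-Greedy algorithm with parameter $\beta=1.15$ is at least $0.522$-competitive against the optimal (integral) offline allocation, i.e. on every instance of Online Budgeted Allocation its expected total reward is at least $0.522\cdot\mathrm{OPT}$. With $\beta=1$ it is $0.508$-competitive.
   Context: Online Budgeted Allocation (OBA): a finite set $I$ of $n$ resources, each with budget $B_i>0$ and per-unit reward $r_i>0$; arrivals $t=1,\dots,T$ arrive sequentially with bids $b_{it}\ge 0$, $i\in I$, revealed on arrival. Each arrival is matched to at most one resource; matching $t$ to $i$ consumes $b_{it}$ units of $i$'s budget and earns $r_i$ per unit consumed, the total reward from $i$ being capped at $r_iB_i$. $\mathrm{OPT}$ is the total reward of an optimal offline integral allocation knowing all bids and budgets. Let $g(x)=e^{\beta(x-1)}$. Fractional Generalized Perturbed-Greedy (fGPG): draw independent seeds $y_i\sim U[0,1]$. Time runs continuously in $[1,T+1)$, with $b_{i\tau}:=b_{it}$ for $\tau\in[t,t+1)$. Set $x_i(1)=0$. At each time $\tau$, let $I(\tau)=\{i: x_i(\tau)<B_i\}$, $i^*(\tau)=\arg\max_{i\in I(\tau)} b_{i\tau}r_i(1-g(y_i))$, and evolve $\frac{dx_i(\tau)}{d\tau}=\mathbb{1}(i=i^*(\tau))\,b_{i\tau}$. Arrival $t$ receives $x_i(t+1)-x_i(t)$ of $i$'s budget and the total reward is $\sum_i r_ix_i(T+1)$. *)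

(* Defs.v *)
From HB Require Import structures.
From mathcomp Require Import all_boot all_order all_algebra.
From mathcomp Require Import all_classical all_reals all_analysis.
From mathcomp Require Import lra.

Set Implicit Arguments.
Unset Strict Implicit.
Unset Printing Implicit Defensive.

Import Order.TTheory GRing.Theory Num.Theory.
Import numFieldNormedType.Exports.

Local Open Scope classical_set_scope.
Local Open Scope ring_scope.

(* The ordinal t : 'I_horizon stands for arrival t.+1, which occupies the time
   interval [t.+1, t.+2[. *)
Record OBA (R : realType) := {
  resource : finType;
  horizon : nat;
  budget : resource -> R;
  unit_reward : resource -> R;
  bid : resource -> 'I_horizon -> R;
  budget_gt0 : forall i, 0 < budget i;
  unit_reward_gt0 : forall i, 0 < unit_reward i;
  bid_ge0 : forall i t, 0 <= bid i t
}.

Section Allocation.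
Context {R : realType}.
Variable inst : OBA R.
Notation I := (resource inst).
Notation T := (horizon inst).

(* [a t = None] leaves arrival t unmatched. *)
Definition allocation_reward (a : {ffun 'I_T -> option I}) : R :=
  \sum_(i : I) unit_reward i *
    Num.min (budget i) (\sum_(t < T | a t == Some i) bid i t).

(* Allocation rewards are nonnegative, so the default 0 does not affect the
   maximum. *)
Definition OPT : R :=
  \big[Num.max/0]_(a : {ffun 'I_T -> option I}) allocation_reward a.

Definition available (x : I -> R -> R) (tau : R) : {set I} :=
  [set i | x i tau < budget i].

Definition perturbation (beta u : R) : R := expR (beta * (u - 1)).

Definition priority (beta : R) (y : I -> R) (t : 'I_T) (i : I) : R :=
  bid i t * unit_reward i * (1 - perturbation beta (y i)).

(* [k = None] exactly when no resource is available; ties in the argmax may be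
   broken arbitrarily. *)
Definition is_argmax (A : {set I}) (f : I -> R) (k : option I) : Prop :=
  if k is Some i then i \in A /\ (forall j, j \in A -> f j <= f i)
  else A = finset.set0.

Definition right_derivative (f : R -> R) (tau l : R) : Prop :=
  h^-1 * (f (tau + h) - f tau) @[h --> 0^'+] --> l.

(* The evolution law at a time tau at which arrival t is present. The right
   hand side of the differential equation jumps when an arrival begins or a
   budget is exhausted, and is right-continuous there; the derivative is hence
   taken from the right. *)
Definition fGPG_step (beta : R) (y : I -> R) (t : 'I_T) (x : I -> R -> R)
    (tau : R) : Prop :=
  exists k : option I,
    is_argmax (available x tau) (priority beta y t) k /\
    (forall i, right_derivative (x i) tau
                 (if k == Some i then bid i t else 0)).

Definition fGPG_run (beta : R) (y : I -> R) (x : I -> R -> R) : Prop :=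
  [/\ forall i, x i 1 = 0,
      forall i, {within `[1, T.+1%:R], continuous (x i)} &
      forall (t : 'I_T) (tau : R),
        t.+1%:R <= tau < t.+2%:R -> fGPG_step beta y t x tau].

Definition run_reward (x : I -> R -> R) : R :=
  \sum_(i : I) unit_reward i * x i T.+1%:R.

End Allocation.

Section Existence.
Context {R : realType}.
Variables (inst : OBA R) (beta : R) (y : resource inst -> R).
Notation I := (resource inst).
Notation T := (horizon inst).

Lemma fGPG_step_local (t : 'I_T) (x x' : I -> R -> R) (tau e : R) : tau < e ->
  (forall i s, tau <= s < e -> x i s = x' i s) ->
  fGPG_step beta y t x tau -> fGPG_step beta y t x' tau.
Proof.
move=> te xx' [k [kmax dx]]; exists k; split.
  suff -> : available x' tau = available x tau by [].
  by apply/setP => i; rewrite !inE xx' // lexx te.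
move=> i; apply: cvg_trans (dx i).
apply: near_eq_cvg; near=> h.
have h0 : 0 < h by near: h; exact: nbhs_right_gt.
have he : h < e - tau by near: h; apply: nbhs_right_lt; rewrite subr_gt0.
by rewrite !xx' ?lexx ?te//; lra.
Unshelve. all: by end_near. Qed.

Definition glue (m : R) (x1 x2 : I -> R -> R) : I -> R -> R :=
  fun i s => x1 i (Num.min s m) + x2 i (Num.max s m) - x1 i m.

Lemma glueL m x1 x2 i s : (forall i, x1 i m = x2 i m) -> s <= m ->
  glue m x1 x2 i s = x1 i s.
Proof. by move=> e sm; rewrite /glue min_l// max_r// e; lra. Qed.

Lemma glueR m x1 x2 i s : (forall i, x1 i m = x2 i m) -> m <= s ->
  glue m x1 x2 i s = x2 i s.
Proof. by move=> e sm; rewrite /glue min_r// max_l//; lra. Qed.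

Lemma glue_continuous m (x1 x2 : I -> R -> R) :
  (forall i, continuous (x1 i)) -> (forall i, continuous (x2 i)) ->
  forall i, continuous (glue m x1 x2 i).
Proof.
move=> c1 c2 i s; apply: cvgB; last exact: cvg_cst.
apply: cvgD; apply: (@continuous_comp _ _ _ _ (_ i) s).
- by apply: continuous_min => //; exact: cvg_cst.
- exact: c1.
- by apply: continuous_max => //; exact: cvg_cst.
- exact: c2.
Qed.

Lemma glue_step t m x1 x2 tau a c : (forall i, x1 i m = x2 i m) ->
  (forall s, a <= s < m -> fGPG_step beta y t x1 s) ->
  (forall s, m <= s < c -> fGPG_step beta y t x2 s) ->
  a <= tau < c -> fGPG_step beta y t (glue m x1 x2) tau.
Proof.
move=> e s1 s2 /andP[at_ tc]; case: (ltP tau m) => tm.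
  apply: (@fGPG_step_local t x1 _ tau m tm); last by apply: s1; rewrite at_.
  by move=> i s /andP[_ /ltW sm]; rewrite glueL.
apply: (@fGPG_step_local t x2 _ tau c tc); last by apply: s2; rewrite tm.
by move=> i s /andP[ts _]; rewrite glueR// (le_trans tm).
Qed.

Lemma argmax_exists (A : {set I}) (f : I -> R) : exists k, is_argmax A f k.
Proof.
have [->|[i0 i0A]] := set_0Vmem A; first by exists None.
exists (Some [arg max_(i > i0 in A) f i]%O) => /=.
by case: Order.TotalTheory.arg_maxP.
Qed.

Lemma fGPG_segment (t : 'I_T) n (x0 : I -> R) (a c : R) : a <= c ->
  (forall i, x0 i <= budget i) -> (#|[set i | (x0 i < budget i)%R]%SET| <= n)%N ->
  exists x : I -> R -> R, [/\ forall i, x i a = x0 i,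
    forall i, continuous (x i), forall i, x i c <= budget i &
    forall tau, a <= tau < c -> fGPG_step beta y t x tau].
Proof.
elim: n x0 a => [|n IH] x0 a ac x0B; set A := [set i | _]%SET => An.
all: have [k kmax] := argmax_exists A (priority beta y t).
all: case: k kmax => [k /= [kA kmax]|/= A0].
- by move: An; rewrite leqn0 cards_eq0 => /eqP A0; rewrite A0 inE in kA.
- exists (fun i _ => x0 i); split=> //; first by move=> i; exact: cst_continuous.
  move=> tau _; exists None; split=> // i.
  rewrite /right_derivative /=.
  by under eq_fun do rewrite subrr mulr0; exact: cvg_cst.
- have Bk : x0 k < budget k by move: kA; rewrite inE.
  have bk0 := bid_ge0 k t.
  pose m := if bid k t == 0 then c
            else Num.min c (a + (budget k - x0 k) / bid k t).
  have mc : m <= c by rewrite /m; case: ifP => // _; rewrite ge_min lexx.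
  have am : a <= m.
    rewrite /m; case: ifP => // _; rewrite le_min ac /= lerDl divr_ge0// subr_ge0.
    exact: ltW.
  have mle s : a <= s < m -> x0 k + bid k t * (s - a) < budget k.
    move=> /andP[as_ sm]; move: sm; rewrite /m; case: ifPn => [/eqP -> _|b0].
      by rewrite mul0r addr0.
    rewrite lt_min => /andP[_]; rewrite -ltrBlDl ltr_pdivlMr ?lt_neqAle ?bk0 1?eq_sym ?b0//.
    by rewrite mulrC; lra.
  have mleE : x0 k + bid k t * (m - a) <= budget k.
    rewrite /m; case: ifPn => [/eqP ->|b0]; first by rewrite mul0r addr0 ltW.
    have bp : 0 < bid k t by rewrite lt_neqAle bk0 eq_sym b0.
    have : Num.min c (a + (budget k - x0 k) / bid k t) - a <= (budget k - x0 k) / bid k t.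
      by rewrite lerBlDl ge_min lexx orbT.
    by rewrite ler_pdivlMr// mulrC; lra.
  pose x1 i s := x0 i + (if i == k then bid k t else 0) * (s - a).
  have x1c i : continuous (x1 i).
    move=> s; apply: cvgD; first exact: cvg_cst.
    apply: cvgM; first exact: cvg_cst.
    by apply: cvgB => //; exact: cvg_cst.
  have x1step s : a <= s < m -> fGPG_step beta y t x1 s.
    move=> asm; exists (Some k); split.
      suff -> : available x1 s = A by [].
      apply/setP => i; rewrite !inE /x1; case: eqP => [->|_].
        by rewrite Bk mle.
      by rewrite mul0r addr0.
    move=> i; rewrite /right_derivative.
    have -> : (Some k == Some i) = (i == k) by rewrite eq_sym.
    have -> : (if i == k then bid i t else 0) = (if i == k then bid k t else 0).
      by case: eqP => [->|].
    set w := (X in _ --> X); apply: cvg_near_cst; near=> h.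
    have h0 : 0 < h by near: h; exact: nbhs_right_gt.
    rewrite /x1 -/w; have -> : x0 i + w * (s + h - a) - (x0 i + w * (s - a)) = h * w by lra.
    by rewrite mulKf ?gt_eqF.
  have x1B i : x1 i m <= budget i.
    by rewrite /x1; case: eqP => [->//|_]; rewrite mul0r addr0.
  have x1a i : x1 i a = x0 i by rewrite /x1 subrr mulr0 addr0.
  move: (mc); rewrite le_eqVlt => /orP[/eqP mEc|mltc].
    by exists x1; rewrite -mEc; split.
  have x1k : x1 k m = budget k.
    move: mltc; rewrite /x1 eqxx /m; case: ifPn => [|b0]; first by rewrite ltxx.
    rewrite gt_min ltxx /= => /ltW ?; rewrite min_r//.
    rewrite [a + _]addrC addrK mulrCA divff// mulr1; lra.
  have [] := IH (x1^~ m) m mc x1B.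
    rewrite -ltnS (leq_trans _ An)// proper_card//; apply/properP; split.
      apply/fintype.subsetP => i; rewrite !inE /x1; case: eqP => [->//|_].
      by rewrite mul0r addr0.
    by exists k => //; rewrite inE x1k ltxx.
  move=> x2 [x2m x2c x2B x2step]; have e i : x1 i m = x2 i m by rewrite x2m.
  exists (glue m x1 x2); split.
  + by move=> i; rewrite glueL.
  + exact: glue_continuous.
  + by move=> i; rewrite glueR.
  + by move=> tau; apply: glue_step.
- exists (fun i _ => x0 i); split=> //; first by move=> i; exact: cst_continuous.
  move=> tau _; exists None; split=> // i.
  rewrite /right_derivative /=.
  by under eq_fun do rewrite subrr mulr0; exact: cvg_cst.
Unshelve. all: by end_near. Qed.

(* Every choice of seeds admits a run. *)
Lemma fGPG_run_exists : exists x, fGPG_run beta y x.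
Proof.
have H n : (n <= T)%N -> exists x : I -> R -> R, [/\ forall i, x i 1 = 0,
    forall i, continuous (x i), forall i, x i n.+1%:R <= budget i &
    forall (t : 'I_T) tau, (t < n)%N -> t.+1%:R <= tau < t.+2%:R ->
      fGPG_step beta y t x tau].
  elim: n => [_|n IH nT].
    exists (fun _ _ => 0); split=> // i; first exact: cst_continuous.
    exact/ltW/budget_gt0.
  have [x1 [x10 x1c x1B x1s]] := IH (ltnW nT).
  have nn : n.+1%:R <= n.+2%:R :> R by rewrite ler_nat.
  have [x2 [x2m x2c x2B x2s]] :=
    @fGPG_segment (Ordinal nT) _ (x1^~ n.+1%:R) _ _ nn x1B (leqnn _).
  have e i : x1 i n.+1%:R = x2 i n.+1%:R by rewrite x2m.
  exists (glue n.+1%:R x1 x2); split.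
  - by move=> i; rewrite glueL// ler1n.
  - exact: glue_continuous.
  - by move=> i; rewrite glueR.
  - move=> t tau; rewrite ltnS leq_eqVlt => /orP[/eqP tn|tn] tt.
      have -> : t = Ordinal nT by exact: val_inj.
      rewrite tn in tt.
      apply: (@glue_step _ _ _ _ _ n.+1%:R n.+2%:R) => // s.
      by case/andP=> /le_lt_trans h /h; rewrite ltxx.
    have t2 : t.+2%:R <= n.+1%:R :> R by rewrite ler_nat.
    apply: (@fGPG_step_local t x1 _ tau t.+2%:R); last exact: x1s.
      by case/andP: tt.
    by move=> i s /andP[_ st]; rewrite glueL// (le_trans (ltW st)).
have [x [x1 xc _ xs]] := H _ (leqnn T).
exists x; split=> // [i|t tau].
  exact: continuous_subspaceT.
exact: xs.
Qed.
End Existence.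

Section Seeds.
Context {R : realType} {d : measure_display} {Omega : measurableType d}.
Variables (P : probability Omega R) (I : finType) (Y : I -> {RV P >-> R}).

Definition mutually_independent : Prop :=
  forall (J : {set I}) (A : I -> set R), (forall i, measurable (A i)) ->
    P (\bigcap_(i in [set` J]) (Y i @^-1` A i)) =
    (\prod_(i in J) P (Y i @^-1` A i))%E.

Definition uniform01 : Prop :=
  forall (i : I) (A : set R), measurable A ->
    distribution P (Y i) A = uniform_prob (@ltr01 R) A.

End Seeds.

(* The process X ranges over all runs, i.e. over all ways to break ties. A run
   is determined by its seeds unless two priorities with positive bids tie,
   which has probability 0; so measurability of the reward need not be
   assumed. *)
Definition fGPG_competitive (R : realType) (beta alpha : R) : Prop :=
  forall (inst : OBA R) (d : measure_display) (Omega : measurableType d)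
    (P : probability Omega R) (Y : resource inst -> {RV P >-> R})
    (X : Omega -> resource inst -> R -> R),
    mutually_independent Y ->
    uniform01 Y ->
    (forall w, fGPG_run beta (fun i => Y i w) (X w)) ->
    ((alpha * OPT inst)%:E <= 'E_P[fun w => run_reward (X w)])%E.

(* Main.v *)
(** Write g(u) = e^(beta (u - 1)) and V_j = r_j (1 - g(y_j)).  The reward r_j of
    a consumed unit of j splits into r_j g(y_j), credited to j, and V_j,
    credited to the arrival.  Fix a resource i and the other seeds, and compare
    a run with the run in which i has seed 1, i.e. is absent.  Adding i only
    lowers the consumption of the other resources, so every arrival t is
    credited at least its credit c_t in the run without i, and since the credit
    is V_j per unit of j whenever it is consumed, the total increase of the
    credits is at most V_i x_i.  If i is not exhausted, every arrival is
    moreover credited at least V_i b_it.  Hence i together with the arrivals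
    that OPT assigns to i collects, per unit bid and with c = c_t / (r_i b_it),
    at least c + min(g(y_i), max(0, 1 - c - g(y_i)) / (1 - g(y_i))).
    Integrating over y_i and using only ln z >= 1 - 1/z, this is at least
    (1 - q - e^(-beta) + ln(1 + q)) / beta for q = 1 / (e^beta - 1), which is
    0.5223.. for beta = 1.15 and 0.5088.. for beta = 1.  Runs depend on the
    seeds only through the order of the priorities, which makes all quantities
    measurable, and almost surely there are no ties. *)
Require Import Defs.
From HB Require Import structures.
From mathcomp Require Import all_boot all_order all_algebra.
From mathcomp Require Import all_classical all_reals all_analysis.
From mathcomp Require Import measurable_realfun measurable_fun_approximation.
From mathcomp Require Import lra ring.

Set Implicit Arguments.
Unset Strict Implicit.
Unset Printing Implicit Defensive.

Import Order.TTheory GRing.Theory Num.Theory.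
Import numFieldNormedType.Exports.

Local Open Scope classical_set_scope.
Local Open Scope ring_scope.

(** * Right derivatives: calculus rules and monotonicity *)

Section RightDerivative.
Context {R : realType}.
Implicit Types (f g : R -> R) (a b s tau l m : R).

Lemma right_derivative_cst a tau : right_derivative (fun=> a) tau 0.
Proof.
rewrite /right_derivative; under eq_fun do rewrite subrr mulr0.
exact: cvg_cst.
Qed.

Lemma right_derivativeD f g tau l m : right_derivative f tau l ->
  right_derivative g tau m -> right_derivative (fun s => f s + g s) tau (l + m).
Proof.
move=> fl gm; apply: cvg_trans (cvgD fl gm); apply: near_eq_cvg; near=> h.
rewrite /= ?fctE; ring.
Unshelve. all: by end_near. Qed.

Lemma right_derivativeZ a f tau l : right_derivative f tau l ->
  right_derivative (fun s => a * f s) tau (a * l).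
Proof.
move=> fl; apply: cvg_trans (@cvgM _ _ _ _ (cst a) _ _ _ (cvg_cst a) fl).
apply: near_eq_cvg; near=> h; rewrite /= ?fctE; ring.
Unshelve. all: by end_near. Qed.

Lemma right_derivative_sum (I : finType) (P : pred I) (F : I -> R -> R)
    (l : I -> R) tau :
  (forall i, P i -> right_derivative (F i) tau (l i)) ->
  right_derivative (fun s => \sum_(i | P i) F i s) tau (\sum_(i | P i) l i).
Proof.
move=> Fl; elim: (index_enum I) => [|i r IH].
  by rewrite big_nil; under eq_fun do rewrite big_nil; exact: right_derivative_cst.
rewrite big_cons; under eq_fun do rewrite big_cons.
by case: ifP => // /Fl Fi; exact: right_derivativeD Fi IH.
Qed.

(** Right continuity keeps the sign of [f] near [tau] unless [f tau] is 0; there the difference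
    quotient commutes with the positive part, because [h] is positive. *)
Lemma right_derivative_pos f tau l : right_derivative f tau l ->
  right_derivative (fun s => Num.max (f s) 0) tau
    (if 0 < f tau then l else if f tau == 0 then Num.max l 0 else 0).
Proof.
move=> fl.
have fc : f (tau + h) @[h --> 0^'+] --> f tau.
  have h0 : (h : R) @[h --> (0:R)^'+] --> (0 : R).
    exact: cvg_at_right_filter.
  have -> : f tau = 0 * l + f tau by rewrite mul0r add0r.
  apply: cvg_trans (cvgD (cvgM h0 fl) (cvg_cst (f tau))).
  apply: near_eq_cvg; near=> h.
  rewrite !fctE /= mulrA divff ?mul1r ?subrK// gt_eqF//.
case: ltgtP => f0.
- have fp : \forall h \near (0:R)^'+, 0 < f (tau + h).
    exact: (cvgr_gt _ fc).
  apply: cvg_trans fl; apply: near_eq_cvg; near=> h.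
  by rewrite !max_l//; apply: ltW => //; near: h.
- have fn : \forall h \near (0:R)^'+, f (tau + h) < 0.
    exact: (cvgr_lt _ fc).
  apply: cvg_near_cst; near=> h.
  by rewrite !max_r ?subrr ?mulr0//; apply: ltW => //; near: h.
- have mc : Num.max z 0 @[z --> l] --> Num.max l 0.
    by apply: continuous_max; [exact: cvg_id | exact: cvg_cst].
  apply: cvg_trans (cvg_comp _ _ fl mc); apply: near_eq_cvg; near=> h.
  have hV : 0 <= h^-1 by rewrite invr_ge0; apply: ltW.
  by rewrite /= -f0 maxxx !subr0 maxr_pMr// mulr0.
Unshelve. all: by end_near. Qed.

(* At a minimum of [f s - e s] other than [b] the right derivative of [f] would
   be at least [e]. *)
Lemma right_derivative_le0 f a b : a <= b -> {within `[a, b], continuous f} ->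
  (forall s, a <= s < b -> exists2 l, right_derivative f s l & l <= 0) ->
  f b <= f a.
Proof.
move=> ab fc fd; rewrite leNgt; apply/negP => fab.
have ltab : a < b.
  by rewrite lt_neqAle ab andbT; apply: contraTneq fab => ->; rewrite ltxx.
(* Half the mean slope: [f s - e * s] is still larger at [b] than at [a], so its minimum lies before
   [b]. *)
pose e := (f b - f a) / (2 * (b - a)).
have e0 : 0 < e by rewrite divr_gt0 ?mulr_gt0 ?subr_gt0.
have gc : {within `[a, b], continuous (fun s => f s - e * s)}.
  move=> s; apply: cvgB; first exact: fc.
  apply: cvgM; first exact: cvg_cst.
  exact: (@continuous_subspaceT _ _ _ id (fun=> cvg_id)).
have [c cab cmin] := EVT_min ab gc.
have [cb|cb] := eqVneq c b.
  have := cmin a; rewrite in_itv/= lexx ab => /(_ isT); rewrite cb.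
  have -> : f b - e * b = f a + e * (b - a) - e * a.
    have : e * (b - a) = (f b - f a) / 2.
      by rewrite /e; field; rewrite subr_eq0 gt_eqF.
    lra.
  by rewrite lerD2r gerDl leNgt mulr_gt0// subr_gt0.
move: cab; rewrite in_itv/= => /andP[ac cb'].
have {cb cb'}cb : c < b by rewrite lt_neqAle cb.
have [|l fl l0] := fd c; first by rewrite ac.
have fe : \forall h \near (0:R)^'+, h^-1 * (f (c + h) - f c) < e.
  by apply: (cvgr_lt _ fl); exact: le_lt_trans e0.
suff : \forall h \near (0:R)^'+, False by move/filter_ex => [].
near=> h.
have h0 : 0 < h by [].
have hb : h < b - c by near: h; apply: nbhs_right_lt; rewrite subr_gt0.
have := cmin (c + h); rewrite in_itv/= => /(_ ltac:(lra)).
have : h^-1 * (f (c + h) - f c) < e by near: h.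
rewrite mulrC ltr_pdivrMr//; lra.
Unshelve. all: by end_near. Qed.

End RightDerivative.

(** * Single runs and the credits of arrivals *)

Definition set_seed (R : Type) (I : eqType) (y : I -> R) (i : I) (u : R) : I -> R :=
  fun j => if j == i then u else y j.

Section Runs.
Context {R : realType}.
Variables (inst : OBA R) (beta : R).
Hypothesis beta_gt0 : 0 < beta.
Notation I := (resource inst).
Notation T := (horizon inst).
Implicit Types (y : I -> R) (x : I -> R -> R) (t : 'I_T) (i j k : I).

(** The share [V_j] of a unit of [j] that is credited to the arrival. *)
Definition discounted_reward y j : R :=
  unit_reward j * (1 - perturbation beta (y j)).

(* Ties between zero priorities are harmless: such an assignment consumes
   nothing. *)
Definition generic_seeds y : bool :=
  [forall j, 0 <= y j < 1] &&
  [forall t, forall j, forall k, (j != k) ==> (0 < bid j t) ==>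
    (priority beta y t j != priority beta y t k)].

(** The credit of an arrival, collected while it is present. *)
Definition arrival_value y x t : R :=
  \sum_j discounted_reward y j * (x j t.+2%:R - x j t.+1%:R).

Lemma priorityE y t j : priority beta y t j = discounted_reward y j * bid j t.
Proof. by rewrite /priority /discounted_reward -mulrA mulrC. Qed.

Lemma perturbation_le1 (u : R) : u <= 1 -> perturbation beta u <= 1.
Proof.
by move=> u1; rewrite /perturbation -[leRHS]expR0 ler_expR pmulr_rle0// subr_le0.
Qed.

Lemma perturbation_lt1 (u : R) : u < 1 -> perturbation beta u < 1.
Proof.
by move=> u1; rewrite /perturbation -[ltRHS]expR0 ltr_expR pmulr_rlt0// subr_lt0.
Qed.

Lemma perturbation1 : perturbation beta 1 = 1.
Proof. by rewrite /perturbation subrr mulr0 expR0. Qed.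

Lemma generic_seeds_itv y j : generic_seeds y -> 0 <= y j < 1.
Proof. by case/andP => /forallP/(_ j). Qed.

Lemma generic_seeds_neq y t j k : generic_seeds y -> j != k -> 0 < bid j t ->
  priority beta y t j != priority beta y t k.
Proof.
by case/andP=> _ /forallP/(_ t)/forallP/(_ j)/forallP/(_ k)/implyP h /h/implyP.
Qed.

Lemma discounted_reward_gt0 y j : generic_seeds y -> 0 < discounted_reward y j.
Proof.
move=> /(generic_seeds_itv j)/andP[_ y1].
by rewrite mulr_gt0 ?unit_reward_gt0// subr_gt0 perturbation_lt1.
Qed.

Lemma arrival_at (tau : R) : 1 <= tau < T.+1%:R ->
  exists t : 'I_T, t.+1%:R <= tau < t.+2%:R.
Proof.
move=> /andP[tau1 tauT]; have tau0 : 0 <= tau by exact: le_trans tau1.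
(* Arrivals are numbered from 0 and time starts at 1, so the arrival present at [tau] is the
   predecessor of the integer part of [tau]. *)
have := Num.Theory.truncn_itv tau0; set n := Num.truncn tau => /andP[ntau taun].
have n0 : (0 < n)%N by rewrite -ltnS -(ltr_nat R); exact: le_lt_trans taun.
have nT : (n.-1 < T)%N.
  by rewrite prednK// -ltnS -(ltr_nat R); exact: le_lt_trans tauT.
by exists (Ordinal nT) => /=; rewrite prednK// ntau.
Qed.

Lemma arrival_end_le t : t.+2%:R <= T.+1%:R :> R.
Proof. by rewrite ler_nat ltnS. Qed.

Section OneRun.
Variables (y : I -> R) (x : I -> R -> R).
Hypothesis xrun : fGPG_run beta y x.

Lemma run_start i : x i 1 = 0. Proof. by case: xrun. Qed.

Lemma run_continuous i (a b : R) : 1 <= a -> b <= T.+1%:R ->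
  {within `[a, b], continuous (x i)}.
Proof.
move=> a1 bT; case: xrun => _ /(_ i) + _; apply: continuous_subspaceW.
by apply: subset_itv; rewrite bnd_simp.
Qed.

Lemma run_step t (tau : R) : t.+1%:R <= tau < t.+2%:R ->
  fGPG_step beta y t x tau.
Proof. by case: xrun => _ _; apply. Qed.

Lemma run_nondecreasing i (a b : R) : 1 <= a -> a <= b -> b <= T.+1%:R ->
  x i a <= x i b.
Proof.
move=> a1 ab bT; rewrite -lerN2.
apply: (@right_derivative_le0 _ (fun s => - x i s)) => //.
  by move=> s; apply: cvgN; exact: run_continuous.
move=> s /andP[as_ sb].
have [|t ts] := @arrival_at s; first by rewrite (le_trans a1)//= (lt_le_trans sb).
have [k [_ dx]] := run_step ts.
exists (-1 * if k == Some i then bid i t else 0).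
  have -> : (fun s => - x i s) = (fun s => -1 * x i s).
    by apply/funext => u; rewrite mulN1r.
  exact/right_derivativeZ/dx.
by rewrite mulN1r oppr_le0; case: ifP => // _; exact: bid_ge0.
Qed.

Lemma run_ge0 i (s : R) : 1 <= s -> s <= T.+1%:R -> 0 <= x i s.
Proof. by move=> s1 sT; rewrite -(run_start i) run_nondecreasing. Qed.

Lemma run_reward_ge0 : 0 <= run_reward x.
Proof.
apply: sumr_ge0 => i _; rewrite mulr_ge0// ?run_ge0// ?ler1n//.
exact/ltW/unit_reward_gt0.
Qed.

Lemma sum_arrival_value :
  \sum_t arrival_value y x t = \sum_j discounted_reward y j * x j T.+1%:R.
Proof.
rewrite exchange_big /=; apply: eq_bigr => j _; rewrite -mulr_sumr; congr (_ * _).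
rewrite -(big_mkord xpredT (fun t : nat => x j t.+2%:R - x j t.+1%:R)).
by rewrite (telescope_sumr (fun t : nat => x j t.+1%:R))// run_start subr0.
Qed.

Lemma arrival_value_ge0 t : (forall j, 0 <= discounted_reward y j) ->
  0 <= arrival_value y x t.
Proof.
move=> V0; apply: sumr_ge0 => j _; rewrite mulr_ge0// subr_ge0.
by apply: run_nondecreasing; rewrite ?ler1n ?ler_nat ?ltnS.
Qed.

Lemma run_reward_split : run_reward x =
  \sum_j unit_reward j * perturbation beta (y j) * x j T.+1%:R +
  \sum_t arrival_value y x t.
Proof.
rewrite sum_arrival_value -big_split /=; apply: eq_bigr => j _.
rewrite /discounted_reward; ring.
Qed.

(** The rate at which the credit of [t] grows; it is 0 once every resource is exhausted. *)
Definition top_priority t (k : option I) : R :=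
  if k is Some j then priority beta y t j else 0.

Lemma right_derivative_value t (tau : R) : t.+1%:R <= tau < t.+2%:R ->
  exists k : option I, is_argmax (available x tau) (priority beta y t) k /\
  right_derivative (fun s => \sum_j discounted_reward y j * x j s) tau
    (top_priority t k).
Proof.
move=> /run_step[k [kmax dx]]; exists k; split=> //.
have := @right_derivative_sum _ _ xpredT _ _ tau
  (fun j _ => @right_derivativeZ _ (discounted_reward y j) _ _ _ (dx j)).
congr right_derivative; case: k {kmax dx} => [k|] /=.
  rewrite (bigD1 k)//= eqxx big1 ?addr0 ?priorityE// => j jk.
  rewrite (_ : Some k == Some j = false) ?mulr0//.
  by apply/eqP => -[]/eqP; rewrite eq_sym (negbTE jk).
by rewrite big1// => j _; rewrite mulr0.
Qed.

Lemma value_continuous (a b : R) : 1 <= a -> b <= T.+1%:R ->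
  {within `[a, b], continuous (fun s => \sum_j discounted_reward y j * x j s)}.
Proof.
move=> a1 bT; apply: continuous_big; first exact: add_continuous.
move=> j _ s; apply: cvgM; first exact: cvg_cst.
exact: run_continuous.
Qed.

Lemma arrival_valueE t : arrival_value y x t =
  \sum_j discounted_reward y j * x j t.+2%:R -
  \sum_j discounted_reward y j * x j t.+1%:R.
Proof. by rewrite -sumrB; apply: eq_bigr => j _; rewrite mulrBr. Qed.

(** A resource with budget left at the end was available all along, so the top priority never falls
    below its own, and an arrival is present for one unit of time. *)
Lemma arrival_value_ge_priority t i : x i T.+1%:R < budget i ->
  priority beta y t i <= arrival_value y x t.
Proof.
move=> xiB; rewrite arrival_valueE.
pose F s := \sum_j discounted_reward y j * x j s.
rewrite -[leRHS]/(F _ - F _).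
suff : priority beta y t i * t.+2%:R - F t.+2%:R <=
       priority beta y t i * t.+1%:R - F t.+1%:R.
  by rewrite -[X in _ * X - _ <= _]natr1 mulrDr mulr1; lra.
have tT := arrival_end_le t.
apply: (@right_derivative_le0 _ (fun s => priority beta y t i * s - F s)).
- by rewrite ler_nat.
- move=> s; apply: cvgB; last by apply: value_continuous => //; rewrite ler1n.
  apply: cvgM; first exact: cvg_cst.
  exact: (@continuous_subspaceT _ _ _ id (fun=> cvg_id)).
move=> s ts; have [k [kmax dF]] := right_derivative_value ts.
exists (priority beta y t i * 1 + -1 * top_priority t k).
  have -> : (fun s => priority beta y t i * s - F s) =
     (fun s => priority beta y t i * s + -1 * F s).
    by apply/funext => u; rewrite mulN1r.
  apply: right_derivativeD; last exact: right_derivativeZ.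
  apply: right_derivativeZ; apply: cvg_near_cst; near=> h.
  by rewrite addrAC subrr add0r mulVf// gt_eqF.
rewrite mulr1 mulN1r subr_le0.
have ia : i \in available x s.
  rewrite inE; apply: le_lt_trans xiB; case/andP: ts => t1s st2.
  apply: run_nondecreasing => //.
    by rewrite (le_trans _ t1s)// ler1n.
  exact: le_trans (ltW st2) _.
case: k kmax {dF} => [k [_ /(_ i ia)]//|/= A0].
by rewrite A0 inE in ia.
Unshelve. all: by end_near. Qed.

End OneRun.
End Runs.

(** * Comparison of runs under different seeds *)

Section Comparison.
Context {R : realType}.
Variables (inst : OBA R) (beta : R).
Hypothesis beta_gt0 : 0 < beta.
Notation I := (resource inst).
Notation T := (horizon inst).
Implicit Types (y : I -> R) (x : I -> R -> R) (t : 'I_T) (i j : I).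
Notation V := (discounted_reward beta).
Notation p := (priority beta).

Lemma discounted_reward1 y j : y j = 1 -> V y j = 0.
Proof. by move=> y1; rewrite /discounted_reward y1 perturbation1 subrr mulr0. Qed.

(* If [x j] overtakes [x' j] while [j] is on top in the first run, then the top
   resource of the second run has a larger priority and is exhausted in the
   first run only; so the weighted excess of [x] over [x'] never grows. *)
Lemma run_compare y y' (D : pred I) x x' : generic_seeds beta y ->
  (forall j, D j -> y' j = y j) -> (forall j, ~~ D j -> y' j = 1) ->
  fGPG_run beta y x -> fGPG_run beta y' x' ->
  forall j (s : R), D j -> 1 <= s -> s <= T.+1%:R -> x j s <= x' j s.
Proof.
move=> ygen yD yND xrun x'run j s Dj s1 sT.
have V0 i : 0 < V y i by exact: discounted_reward_gt0.
pose Phi s := \sum_(i | D i) V y i * Num.max (x i s - x' i s) 0.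
have Phi0 : Phi s <= Phi 1.
  apply: right_derivative_le0 => //.
    apply: continuous_big; first exact: add_continuous.
    move=> i _; have cD : {within `[1, s], continuous (fun s => x i s - x' i s)}.
      move=> u; apply: cvgB.
        exact: (run_continuous xrun (lexx 1) sT).
      exact: (run_continuous x'run (lexx 1) sT).
    move=> u; apply: cvgM; first exact: cvg_cst.
    have mc z : Num.max v 0 @[v --> (z : R)] --> Num.max z 0.
      by apply: continuous_max; [exact: cvg_id | exact: cvg_cst].
    exact: (cvg_comp _ _ (cD u) (mc _)).
  move=> tau /andP[tau1 taus].
  have [|t ts] := @arrival_at _ inst tau.
    by rewrite tau1 (lt_le_trans taus).
  have [k [kmax dx]] := run_step xrun ts.
  have [k' [k'max dx']] := run_step x'run ts.
  pose d i := (if k == Some i then bid i t else 0) +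
    -1 * (if k' == Some i then bid i t else 0).
  have dD i : right_derivative (fun s => x i s - x' i s) tau (d i).
    have -> : (fun s => x i s - x' i s) = (fun s => x i s + -1 * x' i s).
      by apply/funext => u; rewrite mulN1r.
    by apply: right_derivativeD => //; exact: right_derivativeZ.
  pose l i := V y i * (if 0 < x i tau - x' i tau then d i
    else if x i tau - x' i tau == 0 then Num.max (d i) 0 else 0).
  exists (\sum_(i | D i) l i).
    apply: right_derivative_sum => i _.
    exact/right_derivativeZ/right_derivative_pos.
  have [lle0|] := boolP [forall i, D i ==> (l i <= 0)].
    by apply: sumr_le0 => i Di; move/forallP/(_ i)/implyP: lle0; apply.
  (* If some term grows, its resource [i] is on top in the first run but not in the second; the
     resource [m] on top in the second will outweigh it. *)
  rewrite negb_forall => /existsP[i]; rewrite negb_imply -ltNge => /andP[Di li0].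
  have di_gt0 : 0 < d i.
    move: li0; rewrite /l pmulr_rgt0//; case: ifP => // _; case: ifP => _.
      by rewrite lt_max ltxx orbF.
    by rewrite ltxx.
  have Di_ge0 : x' i tau <= x i tau.
    move: li0; rewrite /l pmulr_rgt0// -subr_ge0 le_eqVlt eq_sym.
    by case: (0 < _ - _) => /=; rewrite ?orbT//; case: eqP; rewrite ?ltxx.
  have kk' a b : (Some a == Some b :> option I) = (a == b) by [].
  have [ki ki'] : k = Some i /\ k' != Some i.
    move: di_gt0; rewrite /d; case: (k =P Some i) => [->|_].
      by split=> //; apply: contraTneq di_gt0 => ->; rewrite eqxx mulN1r subrr ltxx.
    rewrite add0r mulN1r oppr_gt0; case: ifP => _; rewrite ?ltxx//.
    by rewrite ltNge bid_ge0.
  have bi : 0 < bid i t.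
    by move: di_gt0; rewrite /d ki eqxx (negbTE ki') mulr0 addr0.
  have [iA itop] : i \in available x tau /\
      (forall j, j \in available x tau -> p y t j <= p y t i).
    by move: kmax; rewrite ki.
  have iA' : i \in available x' tau.
    by move: iA; rewrite !inE; exact: le_lt_trans.
  have pi_gt0 : 0 < p y t i by rewrite priorityE mulr_gt0.
  have [m k'm] : exists m, k' = Some m.
    move: k'max; clear -iA'; case: k' => [m _|/= A0]; first by exists m.
    by rewrite A0 inE in iA'.
  have [mA' mtop] : m \in available x' tau /\
      (forall j, j \in available x' tau -> p y' t j <= p y' t m).
    by move: k'max; rewrite k'm.
  have mi : m != i by rewrite -kk' -k'm.
  have p'i : p y' t i = p y t i by rewrite /priority yD.
  (* Outside [D] the second run has seed 1 and hence priority 0, below that of [i]. *)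
  have Dm : D m.
    apply: contraTT (mtop i iA') => Dm; rewrite -ltNge p'i [X in X < _]priorityE.
    by rewrite discounted_reward1 ?yND// mul0r.
  have p'm : p y' t m = p y t m by rewrite /priority yD.
  have pim : p y t i < p y t m.
    rewrite lt_neqAle generic_seeds_neq// 1?eq_sym//=.
    by have := mtop i iA'; rewrite p'i p'm.
  have mA : x' m tau < x m tau.
    have mA : m \notin available x tau.
      by apply/negP => /itop; rewrite leNgt pim.
    move: mA mA'; rewrite !inE -leNgt => Bx x'B; exact: lt_le_trans Bx.
  (* The terms of [i] and [m] sum to at most [p y t i - p y t m], and all others vanish. *)
  rewrite (bigD1 i)//= (bigD1 m) /=; last by rewrite Dm mi.
  have lm : l m = - p y t m.
    rewrite /l subr_gt0 mA /d ki k'm !kk' eq_sym (negbTE mi) eqxx add0r mulN1r.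
    by rewrite priorityE mulrN.
  have li : l i <= p y t i.
    rewrite /l /d ki k'm !kk' eqxx (negbTE mi) mulr0 addr0 priorityE.
    rewrite ler_wpM2l//; first exact: ltW.
    case: ifP => // _; case: ifP => _; last exact: ltW.
    by rewrite max_l// ltW.
  rewrite big1 => [|a /andP[/andP[Da ai] am]]; first by lra.
  have da : d a = 0.
    by rewrite /d ki k'm !kk' ![_ == a]eq_sym (negbTE ai) (negbTE am) add0r mulr0.
  by rewrite /l da; case: ifP => _; [|case: ifP => _]; rewrite ?maxxx ?mulr0.
have {}Phi0 : Phi s <= 0.
  apply: le_trans Phi0 _; rewrite /Phi big1// => i _.
  by rewrite (run_start xrun) (run_start x'run) subrr maxxx mulr0.
rewrite leNgt; apply/negP => xx'.
suff : 0 < Phi s by rewrite ltNge Phi0.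
rewrite /Phi (bigD1 j)//= ltr_pwDl//.
  by rewrite mulr_gt0// lt_max subr_gt0 xx'.
apply: sumr_ge0 => i _; rewrite mulr_ge0//; first exact: ltW.
by rewrite le_max lexx orbT.
Qed.

Lemma run_unique y x x' : generic_seeds beta y ->
  fGPG_run beta y x -> fGPG_run beta y x' ->
  forall j (s : R), 1 <= s -> s <= T.+1%:R -> x j s = x' j s.
Proof.
move=> ygen xrun x'run j s s1 sT; apply/eqP; rewrite eq_le.
by rewrite !(@run_compare y y xpredT _ _ ygen).
Qed.

Section Removal.
Variables (y : I -> R) (i : I) (x x0 : I -> R -> R).
Hypothesis ygen : generic_seeds beta y.
Hypothesis xrun : fGPG_run beta y x.
(* The largest seed gives [i] priority 0: this is the run without [i]. *)
Hypothesis x0run : fGPG_run beta (set_seed y i 1) x0.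
Notation y0 := (set_seed y i 1).

Let Vy0 j : j != i -> V y0 j = V y j.
Proof. by move=> ji; rewrite /discounted_reward /set_seed (negbTE ji). Qed.

Let Vy0i : V y0 i = 0.
Proof. by rewrite discounted_reward1// /set_seed eqxx. Qed.

Lemma run_le_removal j (s : R) : j != i -> 1 <= s -> s <= T.+1%:R ->
  x j s <= x0 j s.
Proof.
move=> ji; apply: (@run_compare y y0 (predC1 i)) => // k /=.
  by rewrite /set_seed => /negbTE ->.
by rewrite negbK /set_seed => ->.
Qed.

(** Any other resource available without [i] is also available with it, being consumed no more; and
    [i] itself has priority 0 in the run without it. So the credit grows at least as fast with [i]
    at every time. *)
Lemma arrival_value_removal t : arrival_value beta y0 x0 t <= arrival_value beta y x t.
Proof.
rewrite !arrival_valueE.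
pose F s := \sum_j V y j * x j s; pose F0 s := \sum_j V y0 j * x0 j s.
rewrite -[leLHS]/(F0 _ - F0 _) -[leRHS]/(F _ - F _).
suff : F0 t.+2%:R - F t.+2%:R <= F0 t.+1%:R - F t.+1%:R by lra.
have tT := @arrival_end_le _ inst t.
apply: (@right_derivative_le0 _ (fun s => F0 s - F s)).
- by rewrite ler_nat.
- move=> s; apply: cvgB.
    by apply: (value_continuous x0run) => //; rewrite ler1n.
  by apply: (value_continuous xrun) => //; rewrite ler1n.
move=> s ts.
have [k [kmax dF]] := right_derivative_value xrun ts.
have [k0 [k0max dF0]] := right_derivative_value x0run ts.
exists (top_priority beta y0 t k0 + -1 * top_priority beta y t k).
  have -> : (fun s => F0 s - F s) = (fun s => F0 s + -1 * F s).
    by apply/funext => u; rewrite mulN1r.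
  by apply: right_derivativeD => //; exact: right_derivativeZ.
rewrite mulN1r subr_le0.
have top0 : 0 <= top_priority beta y t k.
  case: k {kmax dF} => //= k; rewrite priorityE mulr_ge0 ?bid_ge0//.
  exact/ltW/discounted_reward_gt0.
case: k0 k0max {dF0} => //= j [jA _].
have [->|ji] := eqVneq j i; first by rewrite priorityE Vy0i mul0r.
rewrite priorityE Vy0// -priorityE.
have {}jA : j \in available x s.
  move: jA; rewrite !inE; apply: le_lt_trans; case/andP: ts => t1s st2.
  apply: run_le_removal => //.
    by rewrite (le_trans _ t1s)// ler1n.
  exact: le_trans (ltW st2) _.
case: k kmax {dF top0} => /= [k [_ ktop]|A0]; first exact: ktop.
by rewrite A0 inE in jA.
Qed.

(* Removing [i] can only raise the consumption of the others; both sums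
   telescope. *)
Lemma sum_arrival_value_removal :
  \sum_t (arrival_value beta y x t - arrival_value beta y0 x0 t) <=
  V y i * x i T.+1%:R.
Proof.
rewrite sumrB (sum_arrival_value xrun) (sum_arrival_value x0run).
rewrite (bigD1 i)//= [X in _ - X](bigD1 i)//= Vy0i mul0r add0r.
rewrite -addrA gerDl subr_le0; apply: ler_sum => j ji.
rewrite Vy0// ler_wpM2l//; first exact/ltW/discounted_reward_gt0.
by apply: run_le_removal => //; rewrite ler1n.
Qed.

End Removal.
End Comparison.

(* A lower bound for what a resource with seed [u] gains on a unit bid for
   which the run without that resource pays [c]: either the resource is
   exhausted, which pays [g(u)], or it outbids the arrival. *)
Definition marginal_gain (R : realType) (beta c u : R) : R :=
  Num.min (perturbation beta u)
    (Num.max 0 (1 - c - perturbation beta u) / (1 - perturbation beta u)).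

(** * The gain of one resource and its offline arrivals *)

Section ResourceGain.
Context {R : realType}.
Variables (inst : OBA R) (beta : R).
Hypothesis beta_gt0 : 0 < beta.
Notation I := (resource inst).
Notation T := (horizon inst).
Variables (y : I -> R) (i : I) (x x0 : I -> R -> R).
Hypothesis ygen : generic_seeds beta y.
Hypothesis xrun : fGPG_run beta y x.
Hypothesis x0run : fGPG_run beta (set_seed y i 1) x0.
Notation g := (perturbation beta (y i)).
Notation w t := (unit_reward i * bid i t).
Notation c t := (arrival_value beta (set_seed y i 1) x0 t).
Notation c1 t := (Num.min 1 (c t / w t)).

Lemma marginal_gain_ge0 (a u : R) : u < 1 -> 0 <= marginal_gain beta a u.
Proof.
move=> u1; rewrite /marginal_gain le_min expR_ge0 /= divr_ge0//.
  by rewrite le_max lexx.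
by rewrite subr_ge0 ltW// perturbation_lt1.
Qed.

(** [O] stands for the arrivals that the offline allocation gives to [i], and [kappa] scales their
    bids down to fit the budget. Whether [i] ends up exhausted decides which branch of the minimum
    in [marginal_gain] is used. *)
Lemma resource_gain_ge (O : pred 'I_T) (kappa : R) : 0 <= kappa <= 1 ->
  kappa * \sum_(t | O t) bid i t <= budget i ->
  kappa * (\sum_(t | O t) w t * (c1 t + marginal_gain beta (c1 t) (y i))) <=
  unit_reward i * g * x i T.+1%:R + \sum_(t | O t) arrival_value beta y x t.
Proof.
move=> /andP[k0 k1] kB.
have /andP[yi0 yi1] := generic_seeds_itv i ygen.
have g0 : 0 < g by exact: expR_gt0.
have g1 : g < 1 by exact: perturbation_lt1.
have r0 := unit_reward_gt0 i.
have w0 t : 0 <= w t by rewrite mulr_ge0 ?bid_ge0// ltW.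
have V0 j : 0 <= discounted_reward beta (set_seed y i 1) j.
  rewrite mulr_ge0//; first exact/ltW/unit_reward_gt0.
  rewrite subr_ge0 perturbation_le1// /set_seed; case: ifP => // _.
  by have /andP[_ /ltW] := generic_seeds_itv j ygen.
have c0 t : 0 <= c t by exact: arrival_value_ge0.
have cL t : c t <= arrival_value beta y x t by exact: arrival_value_removal.
have c1w t : w t * c1 t <= c t.
  have [->|wt0] := eqVneq (w t) 0; first by rewrite mul0r.
  have wp : 0 < w t by rewrite lt_neqAle eq_sym wt0 w0.
  by rewrite mulrC -ler_pdivlMr// ge_min lexx orbT.
have c1_ge0 t : 0 <= c1 t by rewrite le_min ler01 divr_ge0.
have [Bx|xB] := leP (budget i) (x i T.+1%:R).
  (* The exhausted budget pays [g] for every scaled bid, and each arrival keeps at least its credit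
     from the run without [i]. *)
  rewrite mulr_sumr; apply: (@le_trans _ _
    (\sum_(t | O t) (unit_reward i * g * (kappa * bid i t) +
      arrival_value beta y x t))).
    apply: ler_sum => t _; rewrite mulrDr mulrDr addrC lerD//.
      rewrite [leRHS](_ : _ = kappa * (w t * g)); last by ring.
      by rewrite !ler_wpM2l// ge_min lexx.
    apply: le_trans (cL t); apply: le_trans (c1w t).
    by rewrite ler_piMl// mulr_ge0.
  rewrite big_split /= lerD2r -mulr_sumr ler_wpM2l ?mulr_ge0 ?(ltW r0) ?(ltW g0)//.
  by rewrite -mulr_sumr (le_trans kB).
(* Not exhausted: each credit is at least [w t * (1 - g)], so its increase over [c t], divided by
   [1 - g], covers the second branch of the gain. *)
apply: (@le_trans _ _
  (\sum_(t | O t) (c t + (arrival_value beta y x t - c t) / (1 - g)))).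
  rewrite mulr_sumr; apply: ler_sum => t _.
  apply: (@le_trans _ _ (w t * (c1 t + marginal_gain beta (c1 t) (y i)))).
    by rewrite ler_piMl// mulr_ge0// addr_ge0// marginal_gain_ge0.
  have Lw : w t * (1 - g) <= arrival_value beta y x t.
    apply: le_trans (arrival_value_ge_priority xrun t xB).
    by rewrite priorityE /discounted_reward; lra.
  have mg : w t * marginal_gain beta (c1 t) (y i) <=
      w t * Num.max 0 (1 - c1 t - g) / (1 - g).
    by rewrite -[leRHS]mulrA ler_wpM2l// ge_min lexx orbT.
  rewrite mulrDr; apply: le_trans (lerD (lexx _) mg) _.
  have h0 : 0 < 1 - g by rewrite subr_gt0.
  have [wt0|wt0] := eqVneq (w t) 0.
    by rewrite wt0 !mul0r addr0 addr_ge0// divr_ge0// ?subr_ge0 ?cL// ltW.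
  have wp : 0 < w t by rewrite lt_neqAle eq_sym wt0 w0.
  have [wc|cw] := leP (w t) (c t).
    have -> : c1 t = 1 by rewrite min_l// ler_pdivlMr// mul1r.
    rewrite subrr sub0r max_l ?oppr_le0 ?(ltW g0)// mulr0 mul0r addr0 mulr1.
    by rewrite (le_trans wc)// lerDl divr_ge0 ?subr_ge0 ?cL// ltW.
  have -> : c1 t = c t / w t by rewrite min_r// ler_pdivrMr// mul1r ltW.
  rewrite mulrCA divff// mulr1 lerD2l ler_pM2r ?invr_gt0//.
  rewrite maxr_pMr ?w0// mulr0 ge_max subr_ge0 cL /=.
  rewrite [leLHS](_ : _ = w t * (1 - g) - c t); first by rewrite lerD2r.
  by rewrite addrAC mulrBr mulrCA divff// mulr1.
(* The share of [i] itself pays for the factor [1 / (1 - g)]: the credits rise by at most [V_i x_i]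
   in total, and [g / (1 - g)] times this is [r_i g x_i]. *)
rewrite -subr_ge0 [leRHS](_ : _ = g / (1 - g) *
  (discounted_reward beta y i * x i T.+1%:R -
   \sum_(t | O t) (arrival_value beta y x t - c t))); last first.
  rewrite /discounted_reward big_split /= -mulr_suml !sumrB; field.
  by rewrite subr_eq0 gt_eqF.
rewrite mulr_ge0 ?divr_ge0 ?(ltW g0) ?subr_ge0 ?(ltW g1)//.
apply: le_trans (sum_arrival_value_removal beta_gt0 ygen xrun x0run).
rewrite [leRHS](bigID O)/= lerDl sumr_ge0// => t _.
by rewrite subr_ge0 cL.
Qed.

End ResourceGain.

(** * Inequalities and numerical bounds for exp and ln *)

Section ExpBounds.
Context {R : realType}.
Implicit Types x a b c beta q : R.

Lemma expR_ge_series x n : 0 <= x -> \sum_(0 <= k < n) x ^+ k / k`!%:R <= expR x.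
Proof.
move=> x0; apply: (@nondecreasing_cvgn_le _ (series (exp_coeff x))).
  apply/nondecreasing_seqP => m.
  by rewrite seriesSr lerDl divr_ge0// exprn_ge0.
exact: is_cvg_series_exp_coeff.
Qed.

(** One squaring with rounding, for chains of bounds that start near 0, where [1 + x] is
    accurate. *)
Lemma expR_ge_double x a b : 0 <= a -> b <= a * a -> a <= expR x ->
  b <= expR (x * 2).
Proof.
move=> a0 ba ax; rewrite expRM_natr expr2.
by apply: le_trans ba _; rewrite ler_pM.
Qed.

(** This is [ln (1 + z) <= z] with [1 + z = 1 / x]. *)
Lemma ln_ge_1BV x : 0 < x -> 1 - x^-1 <= ln x.
Proof.
move=> x0; rewrite -[leRHS]opprK -lnV ?posrE// lerNr opprB.
rewrite -[X in ln X](subrKC 1); apply: le_ln1Dx.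
by rewrite ltrBrDr addNr invr_gt0.
Qed.

(* Both the choice of the threshold [a] and the value [c] are absorbed by
   [ln z >= 1 - 1/z]. *)
Lemma ln_tradeoff beta q a c : 0 < q -> 1 + q^-1 <= expR beta ->
  0 < c < 1 -> 0 < a < 1 ->
  1 - q - expR (- beta) + ln (1 + q) <=
  beta * c + (1 - a - expR (- beta)) + (1 - c) * (ln (1 - c) - ln (1 - a)) +
  c * (ln c - ln a).
Proof.
move=> q0 qb /andP[c0 c1] /andP[a0 a1].
have q1 : 0 < 1 + q by rewrite addr_gt0.
have c1' : 0 < 1 - c by rewrite subr_gt0.
have a1' : 0 < 1 - a by rewrite subr_gt0.
have lnb : ln (1 + q) - ln q <= beta.
  rewrite -ln_div ?posrE// -[leRHS]expRK ler_ln ?posrE ?divr_gt0 ?expR_gt0//.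
  by apply: le_trans qb; rewrite mulrDl mul1r divff ?gt_eqF// addrC.
(* Weighted by [1 - c] and [c], this bound and the next contribute [a - q] besides logarithms of [q]
   and [1 + q]; here [a] cancels the [- a] of the goal, and [lnb] reduces the logarithms to
   [ln (1 + q)]. *)
have h1 : 1 - ((1 - a) * (1 + q)) / (1 - c) <= ln (1 - c) - ln (1 - a) - ln (1 + q).
  have := @ln_ge_1BV ((1 - c) / ((1 - a) * (1 + q))).
  rewrite divr_gt0 ?mulr_gt0// => /(_ isT); rewrite invf_div.
  by rewrite ln_div ?lnM ?posrE ?mulr_gt0//; lra.
have h2 : 1 - (a * q) / c <= ln c - ln a - ln q.
  have := @ln_ge_1BV (c / (a * q)).
  rewrite divr_gt0 ?mulr_gt0// => /(_ isT); rewrite invf_div.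
  by rewrite ln_div ?lnM ?posrE ?mulr_gt0//; lra.
have {h1} : (1 - c) - (1 - a) * (1 + q) <=
    (1 - c) * (ln (1 - c) - ln (1 - a) - ln (1 + q)).
  apply: le_trans (ler_wpM2l (ltW c1') h1).
  by rewrite mulrBr mulr1 mulrCA divff ?gt_eqF// mulr1.
have {h2} : c - a * q <= c * (ln c - ln a - ln q).
  apply: le_trans (ler_wpM2l (ltW c0) h2).
  by rewrite mulrBr mulr1 mulrCA divff ?gt_eqF// mulr1.
have : c * (ln (1 + q) - ln q) <= beta * c by rewrite mulrC ler_wpM2r// ltW.
move: (ln (1 + q)) (ln q) (ln c) (ln a) (ln (1 - c)) (ln (1 - a)) (expR _).
move=> A B C D E F G; lra.
Qed.

Lemma expR_1_ge : (1359%:R / 500%:R) <= expR 1 :> R.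
Proof.
apply: le_trans (@expR_ge_series 1 7 _); last by lra.
by rewrite !big_nat_recr //= big_geq // !factS fact0 !(exprS, expr0); lra.
Qed.

(* [(1 + x / 256) ^ 256 <= e^x], squaring with rounding. *)
Lemma expRN_0457990_ge : (395173%:R / 625000%:R) <=
  expR (- (45799%:R / 100000%:R)) :> R.
Proof.
have -> : - (45799%:R / 100000%:R) =
  - (45799%:R / 25600000%:R) * 2 * 2 * 2 * 2 * 2 * 2 * 2 * 2 :> R by lra.
apply: (@expR_ge_double _ (248487%:R / 312500%:R)); [lra | lra |].
apply: (@expR_ge_double _ (4458583%:R / 5000000%:R)); [lra | lra |].
apply: (@expR_ge_double _ (377723%:R / 400000%:R)); [lra | lra |].
apply: (@expR_ge_double _ (9717549%:R / 10000000%:R)); [lra | lra |].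
apply: (@expR_ge_double _ (9857763%:R / 10000000%:R)); [lra | lra |].
apply: (@expR_ge_double _ (9928627%:R / 10000000%:R)); [lra | lra |].
apply: (@expR_ge_double _ (39857%:R / 40000%:R)); [lra | lra |].
apply: (@expR_ge_double _ (9982109%:R / 10000000%:R)); [lra | lra |].
by apply: le_trans (expR_ge1Dx _); lra.
Qed.

Lemma expR_115_ge : (1579%:R / 500%:R) <= expR (115%:R / 100%:R) :> R.
Proof.
apply: le_trans (@expR_ge_series (115%:R / 100%:R) 8 _); last by lra.
by rewrite !big_nat_recr //= big_geq // !factS fact0 !(exprS, expr0); lra.
Qed.

Lemma expRN_0380349_ge : (6834151%:R / 10000000%:R) <=
  expR (- (380349%:R / 1000000%:R)) :> R.
Proof.
have -> : - (380349%:R / 1000000%:R) =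
  - (380349%:R / 256000000%:R) * 2 * 2 * 2 * 2 * 2 * 2 * 2 * 2 :> R by lra.
apply: (@expR_ge_double _ (8266893%:R / 10000000%:R)); [lra | lra |].
apply: (@expR_ge_double _ (4546123%:R / 5000000%:R)); [lra | lra |].
apply: (@expR_ge_double _ (9535327%:R / 10000000%:R)); [lra | lra |].
apply: (@expR_ge_double _ (97649%:R / 100000%:R)); [lra | lra |].
apply: (@expR_ge_double _ (9881751%:R / 10000000%:R)); [lra | lra |].
apply: (@expR_ge_double _ (99407%:R / 100000%:R)); [lra | lra |].
apply: (@expR_ge_double _ (4985153%:R / 5000000%:R)); [lra | lra |].
apply: (@expR_ge_double _ (4992571%:R / 5000000%:R)); [lra | lra |].
by apply: le_trans (expR_ge1Dx _); lra.
Qed.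

End ExpBounds.

(** * Integral of the marginal gain over the seed *)

Section MarginalGainIntegral.
Context {R : realType}.
Notation mu := (@lebesgue_measure R).

Lemma measurable_fun_invr : measurable_fun setT (@GRing.inv R).
Proof.
have -> : [set: R] = [set z | z != 0] `|` [set 0].
  by apply/seteqP; split => // z _ /=; have [->|] := eqVneq z 0; [right|left].
have o : open [set z : R | z != 0] by exact: open_neq.
have m := open_measurable o.
apply/measurable_funU => //; split.
  apply: open_continuous_measurable_fun => // z; rewrite inE /= => z0.
  exact: inv_continuous.
exact: measurable_fun_set1.
Qed.

Lemma measurable_perturbation beta : measurable_fun setT (@perturbation R beta).
Proof.
apply: measurableT_comp => //; apply: measurable_funM => //.
exact: measurable_funB.
Qed.

Lemma measurable_marginal_gain beta c :
  measurable_fun setT (@marginal_gain R beta c).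
Proof.
have mp := @measurable_perturbation beta.
apply: measurable_minr => //; apply: measurable_funM.
  by apply: measurable_maxr => //; exact: measurable_funB.
apply: (@measurableT_comp _ _ _ _ _ _ (@GRing.inv R)).
  exact: measurable_fun_invr.
exact: measurable_funB.
Qed.

Lemma integral_is_derive (f F : R -> R) (a b : R) : a <= b ->
  (forall u, a <= u <= b -> {for u, continuous f}) ->
  (forall u, a <= u <= b -> is_derive u 1 F (f u)) ->
  (\int[mu]_(u in `[a, b]) (f u)%:E = (F b - F a)%:E)%E.
Proof.
rewrite le_eqVlt => /predU1P[<- _ _|ab fc dF].
  by rewrite set_itv1 integral_set1 subrr.
have Fc u : a <= u <= b -> {for u, continuous F}.
  move=> /dF dFu; apply: differentiable_continuous; apply/derivable1_diffP.
  exact: ex_derive.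
rewrite (@continuous_FTC2 _ f F)//.
- by apply: continuous_in_subspaceT => u; rewrite inE/= in_itv/=; exact: fc.
- split.
  + move=> u; rewrite in_itv/= => /andP[/ltW au /ltW ub].
    have dFu : is_derive u 1 F (f u) by apply: dF; rewrite au.
    exact: ex_derive.
  + by apply: cvg_at_right_filter; apply: Fc; rewrite lexx ltW.
  + by apply: cvg_at_left_filter; apply: Fc; rewrite lexx ltW.
- move=> u; rewrite in_itv/= => /andP[/ltW au /ltW ub].
  have dFu : is_derive u 1 F (f u) by apply: dF; rewrite au.
  by rewrite derive1E derive_val.
Qed.

Variables (beta : R).
Hypothesis beta_gt0 : 0 < beta.
Notation g := (@perturbation R beta).

Lemma is_derive_perturbation (u : R) : is_derive u 1 g (beta * g u).
Proof.
rewrite /perturbation.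
have -> : (fun u : R => expR (beta * (u - 1))) = expR \o (fun u => beta * (u - 1)).
  by [].
have -> : beta * expR (beta * (u - 1)) = expR (beta * (u - 1)) * beta.
  by rewrite mulrC.
apply: is_derive1_comp; apply: is_derive_eq.
by rewrite /GRing.scale /= subr0 mulr1 ?mulr0 ?addr0.
Qed.

Lemma perturbation_continuous (u : R) : {for u, continuous g}.
Proof.
apply: differentiable_continuous; apply/derivable1_diffP.
by have dg := is_derive_perturbation u; exact: ex_derive.
Qed.

Lemma integral_perturbation (s : R) : 0 <= s ->
  (\int[mu]_(u in `[0%R, s]) (g u)%:E = ((g s - g 0) / beta)%:E)%E.
Proof.
move=> s0.
have dG u : 0 <= u <= s -> is_derive u 1 (beta^-1 \*: g) (g u).
  move=> _; have dg := is_derive_perturbation u.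
  by apply: is_derive_eq; rewrite /GRing.scale /= mulKf// gt_eqF.
rewrite (integral_is_derive s0 (fun u _ => @perturbation_continuous u) dG).
by congr EFin; rewrite /= /GRing.scale /=; field; rewrite gt_eqF.
Qed.

(** The integrand is the second branch of the gain, [(1 - c - g) / (1 - g)]. As [g' = beta g] and
    [1 / (1 - g) = 1 + g / (1 - g)], an antiderivative of [1 / (1 - g)] is
    [u - ln (1 - g) / beta]. *)
Lemma integral_outbid (c a b : R) : a <= b -> b < 1 ->
  (\int[mu]_(u in `[a, b]) (1 - c / (1 - g u))%:E =
   ((b - c * (b - ln (1 - g b) / beta)) -
    (a - c * (a - ln (1 - g a) / beta)))%:E)%E.
Proof.
move=> ab b1.
have g1 u : a <= u <= b -> 0 < 1 - g u.
  by move=> /andP[_ ub]; rewrite subr_gt0 perturbation_lt1// (le_lt_trans ub).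
have fc u : a <= u <= b -> {for u, continuous (fun u => 1 - c / (1 - g u))}.
  move=> /g1 gu; apply: cvgB; first exact: cvg_cst.
  apply: cvgM; first exact: cvg_cst.
  apply: cvgV; first by rewrite gt_eqF.
  by apply: cvgB; [exact: cvg_cst | exact: perturbation_continuous].
have dF u : a <= u <= b ->
    is_derive u 1 (fun u => u - c * (u - ln (1 - g u) / beta)) (1 - c / (1 - g u)).
  move=> /g1 gu; have dg := is_derive_perturbation u.
  have dh : is_derive u 1 (fun u => 1 - g u) (- (beta * g u)).
    have -> : (fun u => 1 - g u) = cst 1 - g by [].
    by apply: is_derive_eq; rewrite sub0r.
  have dl : is_derive u 1 (fun u => ln (1 - g u)) ((1 - g u)^-1 * - (beta * g u)).
    have dln := is_derive1_ln gu.
    exact: (@is_derive1_comp _ (@ln R) (fun u => 1 - g u) u _ _ dln dh).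
  have -> : (fun u => u - c * (u - ln (1 - g u) / beta)) =
      id - c \*: (id - beta^-1 \*: (fun u => ln (1 - g u))).
    by apply/funext => v; rewrite !fctE /= /GRing.scale /= [beta^-1 * _]mulrC.
  apply: is_derive_eq; rewrite /GRing.scale /=; field.
  by rewrite !gt_eqF.
exact: integral_is_derive ab fc dF.
Qed.

(** Cut [[0, 1]] at [s <= e]: below [s] the gain is [g], between [s] and [e] it is the outbidding
    term, and beyond [e] a nonnegative rest is dropped. Together with [c], the two explicit
    integrals give the right hand side of [ln_tradeoff] divided by [beta]. *)
Lemma integral_marginal_gain_ge (alpha q c : R) : 0 < q ->
  1 + q^-1 <= expR beta -> alpha <= 1 - expR (- beta) ->
  alpha * beta <= 1 - q - expR (- beta) + ln (1 + q) -> 0 <= c ->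
  (alpha%:E <= c%:E + \int[mu]_(u in `[0%R, 1%R]) (marginal_gain beta c u)%:E)%E.
Proof.
move=> q0 qb al1 al2 c0.
have e0 := expR_gt0 (- beta).
have g_gt0 u : 0 < g u by exact: expR_gt0.
have mgm D : measurable_fun D (fun u => (marginal_gain beta c u)%:E).
  by apply/measurable_EFinP/measurable_funTS; exact: measurable_marginal_gain.
have mg0 u : `[0%R, 1%R]%classic u -> (0 <= (marginal_gain beta c u)%:E)%E.
  rewrite /= in_itv/= => /andP[_ u1]; rewrite lee_fin le_min ltW ?g_gt0//=.
  by rewrite divr_ge0 ?le_max ?lexx// subr_ge0 perturbation_le1.
have [ac|ca] := leP alpha c.
  by rewrite -[X in (X <= _)%E]adde0 leeD ?lee_fin// integral_ge0.
(* This is [g 0 < 1 - c], which places [e] to the right of 0. *)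
have cb : c < 1 - expR (- beta) by exact: lt_le_trans al1.
have c1 : c < 1 by lra.
have g0E : g 0 = expR (- beta) by rewrite /perturbation sub0r mulrN1.
(* The branches of the minimum cross where [g (1 - g) = 1 - c - g], that is [(1 - g)^2 = c]; hence
   the level [1 - sc]. *)
pose sc := Num.sqrt c.
have sc0 : 0 <= sc by exact: sqrtr_ge0.
have scE : sc * sc = c by rewrite -expr2 sqr_sqrtr.
have sc1 : sc < 1 by rewrite -(sqrtr1 R) ltr_sqrt.
have csc : c <= sc by rewrite -scE ler_piMl// ltW.
pose level v := 1 + ln v / beta.
have gl v : 0 < v -> g (level v) = v.
  move=> v0; rewrite /perturbation /level addrC addKr mulrC divfK ?gt_eqF//.
  by rewrite lnK// posrE.
have gmono u v : (g u <= g v) = (u <= v).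
  by rewrite /perturbation ler_expR ler_pM2l// lerD2r.
(* The seed at which the branches cross may be negative and is then replaced by 0; at [e] the
   outbidding term drops to 0. *)
pose s := Num.max 0 (level (1 - sc)); pose e := level (1 - c).
have s0 : 0 <= s by rewrite le_max lexx.
have ge : g e = 1 - c by rewrite gl// subr_gt0.
have e1 : e <= 1 by rewrite -gmono ge perturbation1; lra.
have se : s <= e.
  rewrite ge_max; apply/andP; split; rewrite -gmono ge ?g0E ?gl ?subr_gt0//; lra.
have gs : g s = Num.max (expR (- beta)) (1 - sc).
  rewrite /s; case: (leP (level (1 - sc)) 0) => h.
    by move: (h); rewrite -gmono gl ?subr_gt0// g0E => h'; rewrite max_l.
  by rewrite gl ?subr_gt0// max_r// -g0E -[1 - sc]gl ?subr_gt0// gmono ltW.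
have split_integral :
  (\int[mu]_(u in `[0%R, s]) (g u)%:E +
   \int[mu]_(u in `[s, e]) (marginal_gain beta c u)%:E <=
   \int[mu]_(u in `[0%R, 1%R]) (marginal_gain beta c u)%:E)%E.
  have sub : `[0%R, e]%classic `<=` `[0%R, 1%R]%classic.
    by apply: subset_itv; rewrite bnd_simp.
  apply: le_trans (ge0_subset_integral mu _ _ (mgm _) mg0 sub) => //.
  have -> : `[0%R, e]%classic = (`[0%R, s[ `|` `[s, e])%classic.
    by rewrite -itv_bndbnd_setU// bnd_simp.
  rewrite ge0_integral_setU//=.
  - apply: leeD => //; rewrite -integral_itv_bndo_bndc; last first.
      by apply/measurable_EFinP/measurable_funTS; exact: measurable_perturbation.
    rewrite le_eqVlt; apply/orP; left; apply/eqP; apply: eq_integral => u.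
    rewrite inE/= in_itv/= => /andP[u0 us]; congr EFin.
    have gu : g u < 1 - sc.
      move: us; rewrite /s lt_max ltNge u0 /= => us.
      by rewrite ltNge -[1 - sc]gl ?subr_gt0// gmono -ltNge.
    rewrite /marginal_gain min_l// ler_pdivlMr; last by lra.
    by rewrite le_max; apply/orP; right; nra.
  - exact: mgm.
  - move=> u [|]; rewrite /= in_itv/= => /andP[h1 h2]; apply: mg0;
      rewrite /= in_itv/=; apply/andP; split; lra.
  - rewrite disj_set2E; apply/eqP; rewrite -subset0 => u /=.
    by rewrite !in_itv/= => -[/andP[_ us] /andP[su _]]; move: us; rewrite ltNge su.
suff bound : ((alpha - c)%:E <= \int[mu]_(u in `[0%R, s]) (g u)%:E +
   \int[mu]_(u in `[s, e]) (marginal_gain beta c u)%:E)%E.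
  have := leeD (lexx c%:E) (le_trans bound split_integral).
  by rewrite -EFinD addrC subrK.
rewrite integral_perturbation// g0E.
(* For [c = 0] the logarithm at [e] degenerates. Both cuts are then 1, and the integral of [g] alone
   suffices, by [ln (1 + q) <= q]. *)
have [c00|c00] := eqVneq c 0.
  have gs1 : g s = 1 by rewrite gs /sc c00 sqrtr0 subr0 max_r//; lra.
  apply: le_trans (leeDl _ _); last first.
    apply: integral_ge0 => u; rewrite /= in_itv/= => /andP[h1 h2]; apply: mg0.
    by rewrite /= in_itv/=; apply/andP; split; lra.
  rewrite lee_fin c00 subr0 gs1 ler_pdivlMr//; apply: le_trans al2 _.
  have : ln (1 + q) <= q by apply: le_ln1Dx; lra.
  lra.
have c_gt0 : 0 < c by rewrite lt_neqAle eq_sym c00.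
have e_lt1 : e < 1 by rewrite ltNge -gmono ge perturbation1 -ltNge; lra.
have -> : (\int[mu]_(u in `[s, e]) (marginal_gain beta c u)%:E =
    \int[mu]_(u in `[s, e]) (1 - c / (1 - g u))%:E)%E.
  apply: eq_integral => u; rewrite inE/= in_itv/= => /andP[su ue]; congr EFin.
  have gu1 : g u <= 1 - c by rewrite -ge gmono.
  have gu2 : 1 - sc <= g u.
    by apply: (@le_trans _ _ (g s)); rewrite ?gmono// gs le_max lexx orbT.
  have gp : 0 < 1 - g u by lra.
  rewrite /marginal_gain max_r; last by lra.
  rewrite min_r; first by field; rewrite gt_eqF.
  by rewrite ler_pdivrMr//; nra.
rewrite integral_outbid// -EFinD lee_fin.
(* [ln_tradeoff] holds for every threshold strictly between 0 and 1, which covers a clipped [s] as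
   well. *)
pose a := 1 - g s.
have gsE : g s = 1 - a by rewrite /a; lra.
have gsc : g s <= 1 - c by rewrite -ge gmono.
have lns : ln (1 - a) = beta * (s - 1) by rewrite -gsE /perturbation expRK.
have lne : ln (1 - c) = beta * (e - 1) by rewrite -ge /perturbation expRK.
have a01 : 0 < a < 1 by rewrite /a; have := g_gt0 s; lra.
have c01 : 0 < c < 1 by rewrite c_gt0.
have := ln_tradeoff q0 qb c01 a01.
rewrite lns lne => tradeoff.
rewrite ge subKr -/a gsE -(ler_pM2r beta_gt0).
rewrite [leRHS](_ : _ = 1 - a - expR (- beta) +
   (1 - c) * (beta * (e - 1) - beta * (s - 1)) + c * (ln c - ln a)).
  lra.
by field; rewrite gt_eqF.
Qed.

End MarginalGainIntegral.

(** * The product sigma-algebra on seeds and resampling of one seed *)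

Section SeedSpace.
Context {R : realType} (I : finType).

Definition rectangle (F : I -> set R) : set (I -> R) :=
  [set y | forall i, F i (y i)].

(** The boxes form a pi-system that generates the product sigma-algebra, so the law of the seeds is
    determined by its values on them. *)
Definition measurable_rectangles : set (set (I -> R)) :=
  [set rectangle F | F in [set F | forall i, measurable (F i)]].

Notation seed_space := (g_sigma_algebraType measurable_rectangles).

Lemma rectangleE (T : Type) (Y : T -> I -> R) (F : I -> set R) :
  Y @^-1` rectangle F = \bigcap_(i in [set: I]) ((fun w => Y w i) @^-1` F i).
Proof. by apply/seteqP; split => [w YF i _|w YF i]; exact: YF. Qed.

Lemma measurable_seed (i : I) : measurable_fun setT (fun y : seed_space => y i).
Proof.
move=> _ A mA; rewrite setTI; apply: sub_sigma_algebra.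
exists (fun j => if j == i then A else setT).
  by move=> j; case: ifP.
apply/seteqP; split => y /=; first by move=> /(_ i); rewrite eqxx.
by move=> Ay j; case: eqP => [->|].
Qed.

Lemma measurable_fun_seeds (d : measure_display) (T : measurableType d)
    (Y : T -> seed_space) :
  (forall i, measurable_fun setT (fun w => Y w i)) -> measurable_fun setT Y.
Proof.
move=> mY; apply: (@measurability _ _ T seed_space setT Y measurable_rectangles) => //.
move=> _ [_ [F mF <-] <-]; rewrite setTI rectangleE.
apply: fin_bigcap_measurable => // i _.
by rewrite -[X in measurable X]setTI; exact: mY.
Qed.

Lemma measurable_rectangles_setI : setI_closed measurable_rectangles.
Proof.
move=> _ _ [F mF <-] [G mG <-]; exists (fun i => F i `&` G i).
  by move=> i; exact: measurableI.
apply/seteqP; split => [y FG|y [Fy Gy] i //].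
by split => i; have [] := FG i.
Qed.

Section Resampling.
Context {d : measure_display} {Omega : measurableType d}.
Variables (P : probability Omega R) (Y : I -> {RV P >-> R}).
Hypothesis Yind : mutually_independent Y.
Hypothesis Yunif : uniform01 Y.
Notation U := (uniform_prob (@ltr01 R)).

Definition seeds (w : Omega) : seed_space := fun i => Y i w.

Lemma measurable_seeds : measurable_fun setT seeds.
Proof. by apply: measurable_fun_seeds => i; exact: measurable_funPT. Qed.

Definition resampled_seeds (i : I) (wu : Omega * R) : seed_space :=
  set_seed (seeds wu.1) i wu.2.

Lemma measurable_resampled_seeds i : measurable_fun setT (resampled_seeds i).
Proof.
apply: measurable_fun_seeds => j; rewrite /resampled_seeds /set_seed.
case: (j == i); first exact: measurable_snd.
exact: (measurableT_comp (measurable_funPT (Y j)) measurable_fst).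
Qed.

(** On boxes both laws are products of one-seed probabilities, by independence and uniformity, and
    the pi-system of boxes determines the law. *)
Lemma resampled_seeds_law i (A : set seed_space) : measurable A ->
  pushforward P seeds A = pushforward (P \x U)%E (resampled_seeds i) A.
Proof.
move=> mA.
(* The measure structure on a pushforward takes the measurability proof as an
   argument. *)
pose pushP := pushforward P seeds : {measure set seed_space -> \bar R}.
pose pushPU := pushforward (P \x U)%E (resampled_seeds i) :
  {measure set seed_space -> \bar R}.
pose m1 := pushP measurable_seeds.
pose m2 := pushPU (measurable_resampled_seeds i).
suff : m1 A = m2 A by [].
refine (@measure_unique _ R seed_space measurable_rectangles (fun=> setT)
  erefl _ _ _ m1 m2 _ _ A mA); rewrite /m1 /m2 /=.
- exact: measurable_rectangles_setI.
- by move=> _; exists (fun=> setT) => //; apply/seteqP; split.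
- by rewrite bigcup_const.
- move=> _ [F mF <-]; rewrite /pushforward rectangleE.
  have PE := @Yind [set: I]%SET F mF.
  rewrite (_ : [set` [set: I]%SET] = [set: I]) in PE; last first.
    by apply/seteqP; split => j //= _; rewrite inE.
  rewrite [LHS]PE (bigD1 i) ?inE//=.
  have -> : resampled_seeds i @^-1` rectangle F =
      (\bigcap_(j in [set` ~: [set i]]) (Y j @^-1` F j)) `*` F i.
    apply/seteqP; split => -[w u] /=.
      move=> YF; split; last by have := YF i; rewrite /resampled_seeds /set_seed eqxx.
      move=> j /=; rewrite !inE => ji.
      by have := YF j; rewrite /resampled_seeds /set_seed (negbTE ji).
    move=> [YF Fu] j; rewrite /resampled_seeds /set_seed /=.
    by case: eqVneq => [->//|ji]; apply: (YF j); rewrite /= !inE.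
  rewrite product_measure1E; last 2 first.
  - apply: fin_bigcap_measurable => // j _.
    by rewrite -[X in measurable X]setTI; exact: measurable_funPT.
  - exact: mF.
  transitivity (P (\bigcap_(j in [set` [set~ i]%SET]) (Y j @^-1` F j)) *
    U (F i))%E; last by [].
  rewrite (@Yind [set~ i]%SET F mF) muleC; congr (_ * _)%E; last exact: Yunif (mF i).
  by apply: eq_bigl => j; rewrite !inE.
by move=> _; rewrite /pushforward preimage_setT probability_setT ltry.
Qed.

(** For conditioning on the seeds other than [i]: a fresh uniform seed for [i] leaves the law
    unchanged, and Tonelli separates the integrals. *)
Lemma integral_resample i (f : seed_space -> \bar R) :
  measurable_fun setT f -> (forall y, 0 <= f y)%E ->
  (\int[P]_w f (seeds w) = \int[P]_w \int[U]_u f (set_seed (seeds w) i u))%E.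
Proof.
move=> mf f0.
have mS : measurable_fun setT (f \o resampled_seeds i).
  exact: measurableT_comp mf (measurable_resampled_seeds i).
transitivity (\int[pushforward P seeds]_y f y)%E.
  by rewrite ge0_integral_pushforward//; exact: measurable_seeds.
transitivity (\int[pushforward (P \x U) (resampled_seeds i)]_y f y)%E.
  pose pushP := pushforward P seeds : {measure set seed_space -> \bar R}.
  pose pushPU := pushforward (P \x U)%E (resampled_seeds i) :
    {measure set seed_space -> \bar R}.
  apply: (@eq_measure_integral _ _ _ _ (pushPU (measurable_resampled_seeds i))
    (pushP measurable_seeds)) => A mA _.
  exact: resampled_seeds_law.
rewrite ge0_integral_pushforward//; last exact: measurable_resampled_seeds.
rewrite preimage_setT; apply: (@fubini_tonelli1 _ _ _ _ R P U _ mS) => ?.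
exact: f0.
Qed.

End Resampling.
End SeedSpace.

(** * Measurability through the order of the priorities *)

Section Patterns.
Context {R : realType}.
Variables (inst : OBA R) (beta : R).
Hypothesis beta_gt0 : 0 < beta.
Notation I := (resource inst).
Notation T := (horizon inst).
Notation seeds_space := (g_sigma_algebraType (@measurable_rectangles R I)).
Implicit Types (y : I -> R) (x : I -> R -> R) (t : 'I_T) (i j : I).

(* The seeds enter a run only through the comparisons between priorities. *)
Definition pattern y : {ffun 'I_T * I * I -> bool} :=
  [ffun a => priority beta y a.1.1 a.1.2 <= priority beta y a.1.1 a.2].

Lemma pattern_run y y' x : pattern y = pattern y' ->
  fGPG_run beta y x -> fGPG_run beta y' x.
Proof.
move=> yy' [x1 xc xs]; split=> // t tau /xs[k [kmax dx]]; exists k; split=> //.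
case: k kmax {dx} => //= k [kA ktop]; split=> // j /ktop.
by have /ffunP/(_ (t, j, k)) := yy'; rewrite !ffunE /= => ->.
Qed.

(** One run is fixed for each of the finitely many patterns, so consumption is a function of the
    pattern. The default is met only at patterns that no seeds have. *)
Definition pattern_choice (a : {ffun 'I_T * I * I -> bool}) : I -> R -> R :=
  xget (fun _ _ => 0) [set x | exists2 y, pattern y = a & fGPG_run beta y x].

Definition canonical_run y := pattern_choice (pattern y).

Lemma canonical_runP y : fGPG_run beta y (canonical_run y).
Proof.
rewrite /canonical_run /pattern_choice; case: xgetP => [x _ [y' + ]|].
  exact: pattern_run.
have [x xrun] := fGPG_run_exists beta y.
by move=> /(_ x) /=; case; exists y.
Qed.

Lemma measurable_priority t i :
  measurable_fun setT (fun y : seeds_space => priority beta y t i).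
Proof.
apply: measurable_funM => //; apply: measurable_funB => //.
exact: measurableT_comp (@measurable_perturbation R beta) (measurable_seed i).
Qed.

Lemma measurable_discounted_reward i :
  measurable_fun setT (fun y : seeds_space => discounted_reward beta y i).
Proof.
apply: measurable_funM => //; apply: measurable_funB => //.
exact: measurableT_comp (@measurable_perturbation R beta) (measurable_seed i).
Qed.

Lemma measurable_fun_forall (d : measure_display) (S : measurableType d)
    (J : finType) (f : J -> S -> bool) :
  (forall a, measurable_fun setT (f a)) ->
  measurable_fun setT (fun s => [forall a, f a s]).
Proof.
move=> mf; apply: (measurable_fun_bool true).
rewrite setTI (_ : _ @^-1` _ = \bigcap_(a in [set: J]) (f a @^-1` [set true])).
  apply: fin_bigcap_measurable => // a _.
  by rewrite -[X in measurable X]setTI; exact: mf.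
apply/seteqP; split=> y /=; first by move=> /forallP fy a _; exact: fy.
by move=> fy; apply/forallP => a; exact: fy.
Qed.

(** There are finitely many patterns, each cut out by finitely many comparisons of measurable
    priorities. *)
Lemma measurable_pattern (F : {ffun 'I_T * I * I -> bool} -> R) :
  measurable_fun setT (fun y : seeds_space => F (pattern y)).
Proof.
have mp a : measurable_fun setT (fun y : seeds_space => pattern y == a).
  have -> : (fun y : seeds_space => pattern y == a) = (fun y => [forall b,
      (priority beta y b.1.1 b.1.2 <= priority beta y b.1.1 b.2) == a b]).
    apply/funext => y; apply/eqP/forallP => [<- b|ya]; first by rewrite ffunE.
    by apply/ffunP => b; rewrite ffunE; exact/eqP.
  apply: measurable_fun_forall => b.
  have ml : measurable_fun setT (fun y : seeds_space =>
      priority beta y b.1.1 b.1.2 <= priority beta y b.1.1 b.2).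
    by apply: measurable_fun_ler; exact: measurable_priority.
  case: (a b).
    by apply: eq_measurable_fun ml => s _; rewrite eqb_id.
  by apply: eq_measurable_fun (measurable_neg ml) => s _; rewrite /= eqbF_neg.
move=> _ A mA; rewrite setTI (_ : _ @^-1` A =
  \bigcup_(a in [set a | A (F a)]) [set y | pattern y == a]).
  apply: fin_bigcup_measurable => // a _.
  rewrite -[X in measurable X]setTI.
  exact: (mp a measurableT [set true]).
apply/seteqP; split=> y /=; first by move=> Ay; exists (pattern y) => /=.
by case=> a /= Aa /eqP ->.
Qed.

Lemma measurable_generic_seeds :
  measurable_fun setT (fun y : seeds_space => generic_seeds beta y).
Proof.
apply: measurable_and.
  apply: measurable_fun_forall => j; apply: measurable_and.
    by apply: measurable_fun_ler => //; exact: measurable_seed.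
  by apply: measurable_fun_ltr => //; exact: measurable_seed.
apply: measurable_fun_forall => t; apply: measurable_fun_forall => j.
apply: measurable_fun_forall => k.
case: (j != k) => //=; case: (0 < bid j t) => //=.
by apply: measurable_neg; apply: measurable_fun_eqr; exact: measurable_priority.
Qed.

(** The value 0 off the generic seeds keeps the gains nonnegative and their sum at most the reward
    of any run, for disjoint sets [O i]. *)
Definition resource_gain (O : I -> pred 'I_T) i y : R :=
  if generic_seeds beta y then
    unit_reward i * perturbation beta (y i) * canonical_run y i T.+1%:R +
    \sum_(t | O i t) arrival_value beta y (canonical_run y) t
  else 0.

Lemma measurable_resource_gain O i :
  measurable_fun setT (fun y : seeds_space => resource_gain O i y).
Proof.
apply: measurable_fun_if => //; first exact: measurable_generic_seeds.
apply: measurable_funTS; apply: measurable_funD.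
  apply: measurable_funM; last first.
    exact: (measurable_pattern (fun a => pattern_choice a i T.+1%:R)).
  apply: measurable_funM => //.
  exact: measurableT_comp (@measurable_perturbation R beta) (measurable_seed i).
apply: (eq_measurable_fun (fun y : seeds_space =>
    \sum_(t <- [seq t <- index_enum 'I_T | O i t])
      arrival_value beta y (canonical_run y) t)).
  by move=> y _; rewrite big_filter.
apply: measurable_sum => t; apply: measurable_sum => j.
apply: measurable_funM; first exact: measurable_discounted_reward.
exact: (measurable_pattern (fun a =>
  pattern_choice a j t.+2%:R - pattern_choice a j t.+1%:R)).
Qed.

Lemma resource_gain_ge0 O i y : 0 <= resource_gain O i y.
Proof.
rewrite /resource_gain; case: ifPn => // ygen.
have xrun := canonical_runP y.
apply: addr_ge0.
  rewrite !mulr_ge0 ?expR_ge0 ?(ltW (unit_reward_gt0 i))//.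
  by apply: (run_ge0 xrun) => //; rewrite ler1n.
apply: sumr_ge0 => t _; apply: arrival_value_ge0 => // j.
exact/ltW/discounted_reward_gt0.
Qed.

(** Generic seeds determine the run, so the canonical one has the same reward; and disjointness of
    the sets [O i] counts each credit at most once. *)
Lemma run_reward_ge_gain (O : I -> pred 'I_T) y x : fGPG_run beta y x ->
  (forall i j t, O i t -> O j t -> i = j) ->
  \sum_i resource_gain O i y <= run_reward x.
Proof.
move=> xrun Odisj; rewrite /resource_gain.
have [ygen|_] := boolP (generic_seeds beta y); last first.
  by rewrite big1 ?(run_reward_ge0 xrun).
have x'run := canonical_runP y.
have -> : run_reward x = run_reward (canonical_run y).
  by apply: eq_bigr => i _; rewrite (run_unique beta_gt0 ygen xrun x'run) ?ler1n.
rewrite (run_reward_split x'run) big_split /= lerD2l.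
rewrite (exchange_big_dep xpredT)//=; apply: ler_sum => t _.
have L0 : 0 <= arrival_value beta y (canonical_run y) t.
  by apply: arrival_value_ge0 => // j; exact/ltW/discounted_reward_gt0.
rewrite sumr_const -[leRHS]mulr1n; apply: ler_wpMn2l => //; rewrite leqNgt.
apply/negP => /card_gt1P[i [j [Oi Oj]]]; rewrite !unfold_in in Oi Oj.
by rewrite (Odisj i j t Oi Oj) eqxx.
Qed.

End Patterns.

(** * Expected reward against an offline allocation *)

Section Competitive.
Context {R : realType}.
Variables (inst : OBA R) (beta : R).
Hypothesis beta_gt0 : 0 < beta.
Notation I := (resource inst).
Notation T := (horizon inst).
Notation mu := (@lebesgue_measure R).
Notation U := (uniform_prob (@ltr01 R)).
Notation seeds_space := (g_sigma_algebraType (@measurable_rectangles R I)).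
Notation g := (perturbation beta).
Implicit Types (y : I -> R) (t : 'I_T) (i j k : I).

(** The integral of a nonnegative function is a supremum over simple functions below it. In this
    form monotonicity applies to the reward of an arbitrary process [X]. *)
Lemma ge0_le_integralT (d : measure_display) (S : measurableType d)
    (m : {measure set S -> \bar R}) (f1 f2 : S -> \bar R) :
  (forall s, 0 <= f1 s)%E -> (forall s, f1 s <= f2 s)%E ->
  (\int[m]_s f1 s <= \int[m]_s f2 s)%E.
Proof.
move=> f10 f12.
have f20 s : (0 <= f2 s)%E by exact: le_trans (f12 s).
rewrite !ge0_integralTE//; apply: ereal_sup_le => _ [h hf1 <-].
by exists h => // s; exact: le_trans (hf1 s) (f12 s).
Qed.

Lemma uniform01E (A : set R) : measurable A -> U A = mu (A `&` `[0, 1]).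
Proof.
move=> mA; rewrite -[A in LHS]setIT -(integral_indic U measurableT mA).
rewrite integral_uniform//; last exact/measurable_EFinP/measurable_indic.
by rewrite subr0 invr1 mul1e integral_indic.
Qed.

(** [g] is injective, so the level set has at most one point. *)
Lemma negligible_perturbation_level (a v : R) : a != 0 ->
  mu.-negligible [set u | a * (1 - g u) = v].
Proof.
move=> a0; have [[u0 u0v]|no] := pselect (exists u, a * (1 - g u) = v); last first.
  by exists set0; split=> // u uv; apply: no; exists u.
exists [set u0]; split=> //; first exact: lebesgue_measure_set1.
move=> u /=; rewrite -u0v => /(mulfI a0)/addrI/oppr_inj.
by move=> /expR_inj/(mulfI (lt0r_neq0 beta_gt0))/addIr.
Qed.

(** Each of the finitely many possible ties of [i] at a positive bid pins [u] down to one value, and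
    [u = 1] is one more exception. *)
Lemma ae_set_seed_generic y i : generic_seeds beta y ->
  {ae mu, forall u, 0 <= u <= 1 -> generic_seeds beta (set_seed y i u)}.
Proof.
move=> ygen.
have h1 : {ae mu, forall u : R, u != 1}.
  exists [set 1]; split=> //; first exact: lebesgue_measure_set1.
  by move=> u /= /negP; rewrite negbK => /eqP.
have h2 : {ae mu, forall u : R, forall a : 'I_T * I, 0 < bid i a.1 ->
    bid i a.1 * unit_reward i * (1 - g u) <> priority beta y a.1 a.2}.
  apply: filter_forall => -[t k] /=.
  have [b0|b0] := ltP 0 (bid i t); last exact: aeW.
  have := @negligible_perturbation_level (bid i t * unit_reward i)
    (priority beta y t k).
  rewrite mulf_neq0 ?gt_eqF ?unit_reward_gt0// => /(_ isT).
  by apply: negligibleS => u /= hu; apply: contrapT => ?; exact: hu.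
apply: (@filterS2 _ _ (ae_filter_ringOfSetsType mu) _ _ _ _ h1 h2) => u u1 hu /andP[u0 uu1].
have ult1 : u < 1 by rewrite lt_neqAle u1.
have pj t j : j != i -> priority beta (set_seed y i u) t j = priority beta y t j.
  by move=> ji; rewrite /priority /set_seed (negbTE ji).
have pi t : priority beta (set_seed y i u) t i = bid i t * unit_reward i * (1 - g u).
  by rewrite /priority /set_seed eqxx.
apply/andP; split.
  apply/forallP => j; rewrite /set_seed; case: eqP => _; first by rewrite u0.
  exact: generic_seeds_itv j ygen.
apply/forallP => t; apply/forallP => j; apply/forallP => k.
apply/implyP => jk; apply/implyP => bj.
have [ji|ji] := eqVneq j i.
  rewrite ji in jk bj *; have ki : k != i by rewrite eq_sym.
  by rewrite pi pj//; apply/eqP; exact: (hu (t, k)).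
have [ki|ki] := eqVneq k i; last by rewrite !pj// generic_seeds_neq.
rewrite ki pi pj// eq_sym; have [bi|bi] := ltP 0 (bid i t).
  by apply/eqP; exact: (hu (t, j)).
(* With [i] bidding 0, its priority is 0, while that of [j] is positive. *)
have -> : bid i t = 0 by apply/eqP; rewrite eq_le bi bid_ge0.
by rewrite !mul0r lt_eqF// priorityE mulr_gt0// discounted_reward_gt0.
Qed.

Lemma measurable_set_seed y i :
  measurable_fun setT (fun u : R => set_seed y i u : seeds_space).
Proof.
by apply: measurable_fun_seeds => j; rewrite /set_seed; case: (j == i).
Qed.

Variables (alpha q : R).
Hypothesis alpha_ge0 : 0 <= alpha.
Hypothesis q_gt0 : 0 < q.
Hypothesis q_beta : 1 + q^-1 <= expR beta.
Hypothesis alpha_beta : alpha <= 1 - expR (- beta).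
Hypothesis alpha_q : alpha * beta <= 1 - q - expR (- beta) + ln (1 + q).

(** The run without [i] ignores the seed of [i], so the credits [c t] are constants when
    [resource_gain_ge] is integrated over that seed; [integral_marginal_gain_ge] then gives [alpha]
    per scaled unit of bid value. *)
Lemma resampled_gain_ge (O : I -> pred 'I_T) y i : generic_seeds beta y ->
  ((alpha * (unit_reward i * Num.min (budget i) (\sum_(t | O i t) bid i t)))%:E <=
   \int[U]_u (resource_gain beta O i (set_seed y i u))%:E)%E.
Proof.
move=> ygen; set S := \sum_(t | O i t) bid i t.
have r0 := unit_reward_gt0 i.
have S0 : 0 <= S by apply: sumr_ge0 => t _; exact: bid_ge0.
(* Scales the total bid [S] to what the budget can hold; for [S = 0], division by 0 makes [kappa]
   0. *)
pose kappa : R := Num.min (budget i) S / S.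
have k0 : 0 <= kappa by rewrite divr_ge0// le_min S0 ltW ?budget_gt0.
have kS : kappa * S = Num.min (budget i) S.
  have [S00|S00] := eqVneq S 0; last by rewrite divfK.
  by rewrite S00 mulr0 min_r// ltW// budget_gt0.
have k1 : kappa <= 1.
  have [S00|S00] := eqVneq S 0; first by rewrite /kappa S00 invr0 mulr0.
  by rewrite ler_pdivrMr ?mul1r ?ge_min ?lexx ?orbT// lt_neqAle eq_sym S00.
have mh : measurable_fun setT
    (fun u : R => (resource_gain beta O i (set_seed y i u))%:E).
  apply/measurable_EFinP.
  exact: measurableT_comp (measurable_resource_gain beta O i) (measurable_set_seed y i).
have [x0 x0run] := fGPG_run_exists beta (set_seed y i 1).
pose w t : R := unit_reward i * bid i t.
pose c t : R := Num.min 1 (arrival_value beta (set_seed y i 1) x0 t / w t).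
have w0 t : 0 <= w t by rewrite mulr_ge0 ?bid_ge0// ltW.
have c0 t : 0 <= c t.
  rewrite le_min ler01 divr_ge0// (arrival_value_ge0 x0run)// => j.
  rewrite mulr_ge0//; first exact/ltW/unit_reward_gt0.
  rewrite subr_ge0 perturbation_le1// /set_seed; case: ifP => // _.
  by have /andP[_ /ltW] := generic_seeds_itv j ygen.
rewrite integral_uniform//; last first.
  by move=> u; rewrite lee_fin resource_gain_ge0.
rewrite subr0 invr1 mul1e.
pose l u := (\sum_(t <- [seq t <- index_enum 'I_T | O i t])
  (kappa * w t)%:E * ((c t)%:E + (marginal_gain beta (c t) u)%:E))%E.
have mg0 t (u : R) : 0 <= u <= 1 -> 0 <= marginal_gain beta (c t) u.
  move=> /andP[_ u1]; rewrite le_min expR_ge0 /= divr_ge0 ?le_max ?lexx//.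
  by rewrite subr_ge0 perturbation_le1.
have mmg t D : measurable_fun D (fun u => (marginal_gain beta (c t) u)%:E).
  by apply/measurable_EFinP/measurable_funTS; exact: measurable_marginal_gain.
have term0 t (u : R) : `[0%R, 1%R]%classic u ->
    (0 <= (kappa * w t)%:E * ((c t)%:E + (marginal_gain beta (c t) u)%:E))%E.
  rewrite /= in_itv/= => u01.
  by rewrite -EFinD -EFinM lee_fin mulr_ge0 ?addr_ge0 ?mg0// mulr_ge0.
have msum t : measurable_fun (`[0%R, 1%R]%classic : set R) (fun u : R =>
    (c t)%:E + (marginal_gain beta (c t) u)%:E)%E.
  by apply: emeasurable_funD.
have mterm t : measurable_fun (`[0%R, 1%R]%classic : set R) (fun u : R =>
    (kappa * w t)%:E * ((c t)%:E + (marginal_gain beta (c t) u)%:E))%E.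
  by apply: emeasurable_funM => //; exact: msum.
apply: (@le_trans _ _ (\int[mu]_(u in `[0%R, 1%R]) l u)%E).
  rewrite /l ge0_integral_sum//.
  have -> : alpha * (unit_reward i * Num.min (budget i) S) =
      \sum_(t <- [seq t <- index_enum 'I_T | O i t]) (kappa * w t) * alpha.
    rewrite big_filter -kS /S !mulr_sumr; apply: eq_bigr => t _.
    by rewrite /w; ring.
  rewrite -sumEFin; apply: lee_sum => t _.
  rewrite ge0_integralZl//; last 3 first.
  - exact: msum.
  - move=> u; rewrite /= in_itv/= => u01.
    by rewrite -EFinD lee_fin addr_ge0// mg0.
  - by rewrite lee_fin mulr_ge0.
  rewrite EFinM; apply: lee_wpmul2l; first by rewrite lee_fin mulr_ge0.
  rewrite ge0_integralD; last 5 first.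
  - exact: measurable_itv.
  - by move=> u _; rewrite lee_fin c0.
  - exact: measurable_cst.
  - by move=> u; rewrite /= in_itv/= => u01; rewrite lee_fin mg0.
  - exact: mmg.
  rewrite (integral_cst mu _ (c t)%:E)//= lebesgue_measure_itv/= lte_fin ltr01.
  rewrite oppr0 adde0 mule1.
  exact: integral_marginal_gain_ge q_gt0 q_beta alpha_beta alpha_q (c0 t).
apply: ae_ge0_le_integral => //.
- by move=> u u01; apply: sume_ge0 => t _; exact: term0.
- exact: emeasurable_sum.
- by move=> u _; rewrite lee_fin resource_gain_ge0.
- exact: measurable_funTS.
(* The pointwise bound is for generic seeds, which almost every [u] provides. *)
apply: (@filterS _ _ (ae_filter_ringOfSetsType mu) _ _ _ (ae_set_seed_generic i ygen)) => u ugen.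
rewrite /= in_itv/= => /ugen {}ugen.
rewrite /l big_filter; under eq_bigr do rewrite -EFinD -EFinM.
rewrite sumEFin lee_fin /resource_gain ugen.
have setK : set_seed (set_seed y i u) i 1 = set_seed y i 1.
  by apply/funext => j; rewrite /set_seed; case: eqP.
have x0run' : fGPG_run beta (set_seed (set_seed y i u) i 1) x0 by rewrite setK.
have kB : kappa * \sum_(t | O i t) bid i t <= budget i by rewrite kS ge_min lexx.
have k01 : 0 <= kappa <= 1 by rewrite k0.
have := resource_gain_ge beta_gt0 ugen (canonical_runP beta (set_seed y i u))
  x0run' k01 kB.
apply: le_trans; rewrite mulr_sumr le_eqVlt; apply/orP; left; apply/eqP.
apply: eq_bigr => t _; rewrite -[LHS]mulrA setK.
by have -> : set_seed y i u i = u by rewrite /set_seed eqxx.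
Qed.

Section Expectation.
Context {d : measure_display} {Omega : measurableType d}.
Variables (P : probability Omega R) (Y : I -> {RV P >-> R}).
Hypothesis Yind : mutually_independent Y.
Hypothesis Yunif : uniform01 Y.

(** Given the other seeds, a tie between [j] and [k] at a positive bid of [j] fixes the seed of [j];
    after resampling that seed, the tie has probability 0. *)
Lemma ae_generic_seeds : {ae P, forall w, generic_seeds beta (seeds Y w)}.
Proof.
have h1 : {ae P, forall w, forall j, 0 <= Y j w < 1}.
  apply: filter_forall => j; exists (Y j @^-1` ~` `[0, 1[); split.
  - by rewrite -[X in measurable X]setTI; apply: measurable_funPT => //; exact: measurableC.
  - have mA : measurable (~` `[0%R, 1%R[%classic : set R) by exact: measurableC.
    have := @Yunif j _ mA; rewrite /distribution /pushforward => ->.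
    rewrite uniform01E//; apply/eqP; rewrite -measure_le0.
    (* The complement of [[0, 1[] meets [[0, 1]] in the point 1 only. *)
    rewrite -(lebesgue_measure_set1 (1 : R)) le_measure ?inE//.
      exact: measurableI.
    move=> u [/= + ]; rewrite !in_itv/= => h /andP[u0 u1].
    by apply/eqP; rewrite eq_le u1 leNgt; apply/negP => u1'; apply: h; rewrite u0.
  - by move=> w /=; rewrite in_itv/=.
have h2 : {ae P, forall w, forall a : 'I_T * I * I, a.1.2 != a.2 ->
    0 < bid a.1.2 a.1.1 ->
    priority beta (seeds Y w) a.1.1 a.1.2 != priority beta (seeds Y w) a.1.1 a.2}.
  apply: filter_forall => -[[t j] k] /=.
  have [jk|jk] := eqVneq j k; first exact: aeW.
  have [bj|bj] := ltP 0 (bid j t); last exact: aeW.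
  pose B : set seeds_space := [set y | priority beta y t j == priority beta y t k].
  have mB : measurable B.
    have mE : measurable_fun setT (fun y : seeds_space =>
        priority beta y t j == priority beta y t k).
      by apply: measurable_fun_eqr; exact: measurable_priority.
    by rewrite -[B]setTI; exact: (mE measurableT [set true]).
  exists (seeds Y @^-1` B); split.
  - by rewrite -[X in measurable X]setTI; exact: measurable_seeds.
  - have mSB : measurable (seeds Y @^-1` B).
      by rewrite -[X in measurable X]setTI; exact: measurable_seeds.
    pose f (y : seeds_space) := (\1_B y)%:E : \bar R.
    have mf : measurable_fun setT f by exact/measurable_EFinP/measurable_indic.
    have f0 y : (0 <= f y)%E by rewrite lee_fin.
    transitivity (\int[P]_w f (seeds Y w))%E.
      rewrite -[X in P X]setIT -integral_indic//.
    rewrite (integral_resample Yind Yunif j mf f0).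
    apply: integral0_eq => w _.
    pose A : set R := [set u | bid j t * unit_reward j * (1 - g u) =
      priority beta (seeds Y w) t k].
    have BA u : B (set_seed (seeds Y w) j u) = A u.
      rewrite /B /A /=; apply/propext; split.
        by move=> /eqP; rewrite /priority /set_seed eqxx eq_sym (negbTE jk).
      by move=> h; apply/eqP; rewrite /priority /set_seed eqxx eq_sym (negbTE jk).
    have mA : measurable A.
      have -> : A = (fun u => set_seed (seeds Y w) j u : seeds_space) @^-1` B.
        by apply/funext => u; rewrite -BA.
      by rewrite -[X in measurable X]setTI; exact: measurable_set_seed.
    transitivity (\int[U]_u (\1_A u)%:E)%E.
      apply: eq_integral => u _; rewrite /f !indicE; congr (_%:R%:E); congr nat_of_bool.
      by apply/idP/idP; rewrite !inE BA.
    rewrite integral_indic// setIT -[LHS]/(U A) uniform01E//; apply/eqP; rewrite -measure_le0.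
    have bj0 : bid j t * unit_reward j != 0.
      by rewrite mulf_neq0 ?gt_eqF ?unit_reward_gt0.
    have /negligibleP A0 := negligible_perturbation_level
      (priority beta (seeds Y w) t k) bj0.
    rewrite -(A0 mA) le_measure ?inE//; exact: measurableI.
  - move=> w /= h; apply/negPn/negP => h'; exact: h.
apply: (@filterS2 _ _ (ae_filter_ringOfSetsType P) _ _ _ _ h1 h2) => w w1 w2.
apply/andP; split; first exact/forallP.
apply/forallP => t; apply/forallP => j; apply/forallP => k.
by apply/implyP => jk; apply/implyP => bj; exact: (w2 (t, j, k)).
Qed.

(** The reward dominates the sum of the gains, and each gain is integrated by resampling the seed of
    its own resource. *)
Lemma expected_reward_ge (a : {ffun 'I_T -> option I})
    (X : Omega -> I -> R -> R) :
  (forall w, fGPG_run beta (fun i => Y i w) (X w)) ->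
  ((alpha * allocation_reward a)%:E <= \int[P]_w (run_reward (X w))%:E)%E.
Proof.
move=> Xrun; pose O i t := a t == Some i.
have Odisj i j t : O i t -> O j t -> i = j.
  by rewrite /O => /eqP -> /eqP[].
pose h i (y : seeds_space) := (resource_gain beta O i y)%:E.
have mh i : measurable_fun setT (h i).
  by apply/measurable_EFinP; exact: (measurable_resource_gain beta O i).
have h0 i y : (0 <= h i y)%E by rewrite lee_fin resource_gain_ge0.
apply: (@le_trans _ _ (\int[P]_w \sum_(i <- index_enum I) h i (seeds Y w))%E);
    last first.
  apply: ge0_le_integralT => w; first exact: sume_ge0.
  by rewrite sumEFin lee_fin; exact: run_reward_ge_gain (Xrun w) Odisj.
rewrite ge0_integral_sum//; last first.
  by move=> i; exact: measurableT_comp (mh i) (measurable_seeds Y).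
rewrite /allocation_reward mulr_sumr -sumEFin; apply: lee_sum => i _.
rewrite (integral_resample Yind Yunif i (mh i) (h0 i)).
set v := alpha * _.
have v0 : 0 <= v.
  rewrite mulr_ge0// mulr_ge0//; first exact/ltW/unit_reward_gt0.
  rewrite le_min (ltW (budget_gt0 i)) sumr_ge0// => t _; exact: bid_ge0.
pose G : set Omega := [set w | generic_seeds beta (seeds Y w)].
have mG : measurable G.
  have mE : measurable_fun setT (fun w => generic_seeds beta (seeds Y w)).
    exact: measurableT_comp (measurable_generic_seeds beta) (measurable_seeds Y).
  by rewrite -[G]setTI; exact: (mE measurableT [set true]).
have PG : P G = 1%E.
  have GC0 : P (~` G) = 0%E.
    by apply/negligibleP; [exact: measurableC | exact: ae_generic_seeds].
  by rewrite -[G]setCK probability_setC ?GC0 ?sube0//; exact: measurableC.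
(* The bound [v] is available at generic seeds, which form the event [G] of probability 1. *)
apply: (@le_trans _ _ (\int[P]_w (v%:E * (\1_G w)%:E))%E).
  rewrite ge0_integralZl//; last exact/measurable_EFinP/measurable_indic.
  by rewrite integral_indic// setIT -[X in (_ * X)%E]/(P G) PG mule1.
apply: ge0_le_integralT => w.
  by rewrite mule_ge0// lee_fin.
rewrite indicE; case: (boolP (w \in G)) => [|_].
  by rewrite inE => wG; rewrite mule1; exact: resampled_gain_ge.
by rewrite mule0 integral_ge0// => u _; exact: h0.
Qed.

End Expectation.
End Competitive.

(** * The competitive ratio and its numerical instances *)

Lemma fGPG_competitive_of (R : realType) (beta alpha q : R) :
  0 < beta -> 0 <= alpha -> 0 < q -> 1 + q^-1 <= expR beta ->
  alpha <= 1 - expR (- beta) ->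
  alpha * beta <= 1 - q - expR (- beta) + ln (1 + q) ->
  fGPG_competitive beta alpha.
Proof.
move=> b0 a0 q0 qb ab aq inst d Omega P Y X Yind Yunif Xrun.
rewrite unlock /OPT.
(* The bound holds for the default 0, as rewards are nonnegative, and passes to the larger of two
   values. *)
apply: (big_ind (fun v : R => (alpha * v)%:E <= _)%E).
- rewrite mulr0 integral_ge0// => w _; rewrite lee_fin.
  exact: run_reward_ge0 (Xrun w).
- by move=> u v hu hv; case: (leP u v).
- by move=> a _; exact: (expected_reward_ge b0 a0 q0 qb ab aq Yind Yunif).
Qed.

(* The optimal [q] is [1 / (e^beta - 1)]; here [L], [e], [q], [l] are rational
   approximations of [e^beta], [e^-beta], the optimal [q] and [ln (1 + q)]. *)
Lemma fGPG_competitive_num (R : realType) (beta alpha L e q l v : R) :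
  0 < beta -> 0 <= alpha -> 1 < L -> L * e = 1 -> (L - 1) * q = 1 ->
  L <= expR beta -> v <= expR (- l) -> 1 - e <= v -> alpha <= 1 - e ->
  alpha * beta <= 1 - q - e + l -> fGPG_competitive beta alpha.
Proof.
move=> b0 a0 L1 Le Lq Lb vl.
have L0 : 0 < L by exact: lt_trans L1.
have L10 : 0 < L - 1 by rewrite subr_gt0.
have -> : e = L^-1 by rewrite -[LHS](mulKf (lt0r_neq0 L0)) Le mulr1.
have -> : q = (L - 1)^-1 by rewrite -[LHS](mulKf (lt0r_neq0 L10)) Lq mulr1.
move=> vL aL abl.
have eL : expR (- beta) <= L^-1 by rewrite expRN lef_pV2 ?posrE ?expR_gt0.
have lq : l <= ln (1 + (L - 1)^-1).
  (* As [1 + q = 1 / (1 - e)], the claim amounts to [1 - e <= expR (- l)]. *)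
  have -> : 1 + (L - 1)^-1 = (1 - L^-1)^-1 by field; rewrite !gt_eqF.
  have L1V : 0 < 1 - L^-1 by rewrite subr_gt0 invf_lt1.
  rewrite lnV ?posrE// lerNr -[leRHS]expRK ler_ln ?posrE ?expR_gt0//.
  exact: le_trans vL vl.
apply: (@fGPG_competitive_of _ _ _ (L - 1)^-1) => //.
- by rewrite invr_gt0.
- by rewrite invrK addrC subrK.
- by apply: le_trans aL _; rewrite lerD2l lerN2.
- by apply: le_trans abl _; rewrite lerD// lerD2l lerN2.
Qed.

Theorem theorem3 (R : realType) :
  @fGPG_competitive R (115%:R / 100%:R) (522%:R / 1000%:R) /\
  @fGPG_competitive R 1 (508%:R / 1000%:R).
Proof.
split.
  (* Here [L] is 3.158, and [l = 0.380349] is just large enough for [1 - q - e + l] to exceed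
     0.6003, which is 1.15 times 0.522. Below, [L] is 2.718, and [l = 0.45799] just reaches
     0.508. *)
  by apply: (@fGPG_competitive_num _ _ _ _ (1000%:R / 3158%:R)
    (1000%:R / 2158%:R) _ _ _ _ _ _ _ (@expR_115_ge R) (@expRN_0380349_ge R)); lra.
by apply: (@fGPG_competitive_num _ _ _ _ (1000%:R / 2718%:R)
  (1000%:R / 1718%:R) _ _ _ _ _ _ _ (@expR_1_ge R) (@expRN_0457990_ge R)); lra.
Qed.
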